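(* Let $\Omega$ be a bounded strictly convex domain in $\mathbb{R}^n$ with smooth boundary and diameter $D$, let $q(x)\in C^\infty(\overline \Omega)$, and let $u(x)$ be a nonnegative first eigenfunction of the operator $\Delta-q$ on $\Omega$ with Dirichlet boundary data. Let $\psi(s)\in C^\infty([0,D/2])$ with $\psi(0)=0$, $\psi_{ss}(0)=0$ and $\psi_s>0$. Suppose that $$E_q(x,y)\geq \varphi(r(x,y)/2)$$ for all $x,y\in\Omega$, where $\varphi$ is a nonnegative function on $[0,D/2]$. Then $$E_f(x,y)\geq m\psi(r(x,y)/2)$$ for any $x,y\in \Omega$, where $f=-\log u$ and $$m=\min_{s\in [0,D/2]}\frac{\psi_{ss}+\sqrt{\psi_{ss}^2+4\varphi\psi\psi_s}}{2\psi_s\psi}.$$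
   Context: For $x,y\in\mathbb{R}^n$ let $r(x,y)=\|x-y\|$, and for $x\neq y$ let $N(x,y)=\frac{y-x}{\|y-x\|}$ and $\theta(s,x,y)=x+sN(x,y)$. For a function $g$ on $\Omega$, $E_g(x,y)=\int_0^{r(x,y)}\nabla^2 g(\theta(s,x,y))(N(x,y),N(x,y))\,ds$ (equal to $0$ when $x=y$). Subscripts $s$ denote derivatives in $s$. *)

(* Defs.v *)
From HB Require Import structures.
From mathcomp Require Import all_boot all_order all_algebra.
From mathcomp Require Import all_classical all_reals all_analysis.
Set Implicit Arguments. Unset Strict Implicit. Unset Printing Implicit Defensive.
Import Order.TTheory GRing.Theory Num.Theory.
Import numFieldNormedType.Exports.
Local Open Scope classical_set_scope.
Local Open Scope ring_scope.

Section Defs.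
Variables (R : realType) (n : nat).
Local Notation V := 'rV[R]_n.

Definition enorm (x : V) : R := Num.sqrt (\sum_(i < n) x ord0 i ^+ 2).
Definition rdist (x y : V) : R := enorm (x - y).

Definition Ndir (x y : V) : V := (rdist x y)^-1 *: (y - x).
Definition theta (s : R) (x y : V) : V := x + s *: Ndir x y.

Definition ebasis (i : 'I_n) : V := delta_mx 0 i.

Fixpoint iterD (s : seq 'I_n) (f : V -> R) : V -> R :=
  match s with
  | [::] => f
  | i :: s' => 'D_(ebasis i) (iterD s' f)
  end.

Definition Ck_on (k : nat) (U : set V) (f : V -> R) : Prop :=
  forall s : seq 'I_n, (size s <= k)%N -> forall x, U x ->
    {for x, continuous (iterD s f)} /\
    ((size s < k)%N -> forall i, derivable (iterD s f) x (ebasis i)).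

Definition smooth_on (U : set V) (f : V -> R) : Prop := forall k, Ck_on k U f.

Definition hess_dir (g : V -> R) (p v : V) : R := 'D_v ('D_v g) p.

Definition laplacian (u : V -> R) (x : V) : R :=
  \sum_(i < n) hess_dir u x (ebasis i).

Definition Eg (g : V -> R) (x y : V) : R :=
  if x == y then 0 else
  \int[lebesgue_measure]_(s in `[0, rdist x y]) hess_dir g (theta s x y) (Ndir x y).

Definition bounded_domain (O : set V) : Prop :=
  open O /\ connected O /\ O !=set0 /\ exists M : R, forall x, O x -> enorm x <= M.

Definition smooth_boundary (O : set V) : Prop :=
  exists rho : V -> R, smooth_on setT rho /\
    (forall x, O x <-> rho x < 0) /\
    (forall x, rho x = 0 -> exists i, 'D_(ebasis i) rho x != 0).

Definition strictly_convex (O : set V) : Prop :=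
  forall x y, closure O x -> closure O y -> x != y ->
    forall t : R, 0 < t < 1 -> O ((1 - t) *: x + t *: y).

Definition diameter (O : set V) : R :=
  sup [set d | exists x y, O x /\ O y /\ d = rdist x y].

Definition smooth_closure (O : set V) (q : V -> R) : Prop :=
  exists U : set V, open U /\ closure O `<=` U /\ smooth_on U q.

Definition dirichlet_eigen (O : set V) (q u : V -> R) (lam : R) : Prop :=
  Ck_on 2 O u /\
  {within closure O, continuous u} /\
  (forall x, closure O x -> ~ O x -> u x = 0) /\
  (exists x, O x /\ u x != 0) /\
  (forall x, O x -> laplacian u x - q x * u x = - lam * u x).

Definition first_eigenfunction (O : set V) (q u : V -> R) : Prop :=
  exists lam, dirichlet_eigen O q u lam /\
    forall v mu, dirichlet_eigen O q v mu -> lam <= mu.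

End Defs.

Definition smooth_interval (R : realType) (a b : R) (psi : R -> R) : Prop :=
  exists e : R, 0 < e /\ forall k x, a - e < x < b + e ->
    derivable (derive1n k psi) x 1.

(* Main.v *)
Require Import Defs.
From HB Require Import structures.
From mathcomp Require Import all_boot all_order all_algebra.
From mathcomp Require Import all_classical all_reals all_analysis.
From mathcomp Require Import ring lra.
Set Implicit Arguments.
Unset Strict Implicit.
Unset Printing Implicit Defensive.
Import Order.TTheory GRing.Theory Num.Theory.
Import numFieldNormedType.Exports.
Local Open Scope classical_set_scope.
Local Open Scope ring_scope.

(** Write [f = - ln u], so that [Delta f = |grad f|^2 - q + lam].  Instead of the
gradients of [f], compare its values at two pairs of points with the same midpoint [z]
on a common line: with [Xi' = w] the claim [E_f >= w (r / 2)] says that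
[f (z + b e) + f (z - b e) - Xi b] is nondecreasing in [b >= 0].

For [|a| <= b] the defect of this monotonicity is a function of [(z, e, b, a)].  At an
interior extremum the first order conditions control the gradients, and moving the two
halves of the configuration by vectors that are mirror images in the hyperplane
orthogonal to [e] controls the Laplacians.  The result is a contradiction as soon as
[w w' - w'' < phi] and [E_q >= phi].  For [0 < m' < m] this strict inequality holds for
[w = m' psi], by the definition of [m] as a minimum of larger roots of quadratics.

No regularity of [u] at the boundary is needed, because at the inner pair [u] is
replaced by [u + eps h], where [h >= 1] and [Delta h - q h + lam h < 0] on the boundary:
the defect then tends to [- oo] at the boundary, while the error caused by [eps h] is
at most of order [eps] and is negative when an inner point is close to the boundary.
Configurations with [b - |a|] bounded below are ruled out for small [eps], and the others
have a small defect. *)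

(** * Derivatives on the line *)

(** Since [ln u] has Laplacian [q - lam - |grad ln u|^2], the second order condition at a maximum of
    the defect involves the four values of [q], the four squared gradients and [w' b - w' a]. The
    first order conditions bound the contribution of the gradients by [(w b^2 - w a^2) / 2]. What
    remains is the increment from [|a|] to [b] of [q (z + s e) + q (z - s e) - w s^2 / 2 + w' s],
    whose derivative in [s] is [E_q - w w' + w''] for the pair [z - s e], [z + s e]. This is the
    origin of the differential inequality for [w]. The obstacle is the boundary, where all four
    logarithms may diverge together. Perturbing the inner pair alone keeps the subtracted logarithms
    bounded below, and the exponential of the defect is then continuous up to the boundary, so that
    it has a maximum by compactness. The margin in the inequality for [w] is carried along as a
    function [k] with primitive [K]: the error of order [eps] has to exceed [K b - K |a|], which
    vanishes only if the two pairs coincide. *)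

Lemma is_derive_line (R : realType) (V : normedModType R) (g : V -> R)
    (x v : V) (t d : R) :
  is_derive (x + t *: v) v g d <-> is_derive t 1 (fun s : R => g (x + s *: v)) d.
Proof.
have E : (fun h : R => h^-1 *: ((g \o shift (x + t *: v)) (h *: v)
                               - g (x + t *: v))) =
         (fun h : R => h^-1 *: (((fun s : R => g (x + s *: v)) \o shift t)
                               (h *: 1) - g (x + t *: v))).
  apply/funext => h /=; congr (_ *: (g _ - _)).
  by rewrite [h *: 1]mulr1 scalerDl addrCA.
split=> -[dg dE]; split.
- by move: dg; rewrite /derivable E.
- by move: dE; rewrite /derive E.
- by move: dg; rewrite /derivable E.
- by move: dE; rewrite /derive E.
Qed.

Lemma is_derive_line0 (R : realType) (V : normedModType R) (g : V -> R)
    (x v : V) (d : R) :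
  is_derive x v g d <-> is_derive (0 : R) 1 (fun s : R => g (x + s *: v)) d.
Proof. by rewrite -is_derive_line scale0r addr0. Qed.

Lemma is_derive_cvg (R : realType) (f : R -> R) (x d : R) :
  is_derive x 1 f d -> h^-1 * (f (x + h) - f x) @[h --> (0:R)^'] --> d.
Proof.
move=> [df <-].
have -> : (fun h : R => h^-1 * (f (x + h) - f x)) =
  (fun h : R => h^-1 *: ((f \o shift x) (h *: 1) - f x)).
  by apply/funext => h; rewrite /= [h *: 1]mulr1 [x + h]addrC.
exact: df.
Qed.

Lemma cvg_is_derive (R : realType) (f : R -> R) (x d : R) :
  h^-1 * (f (x + h) - f x) @[h --> (0:R)^'] --> d -> is_derive x 1 f d.
Proof.
have -> : (fun h : R => h^-1 * (f (x + h) - f x)) =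
  (fun h : R => h^-1 *: ((f \o shift x) (h *: 1) - f x)).
  by apply/funext => h; rewrite /= [h *: 1]mulr1 [x + h]addrC.
move=> c; split; first by apply/cvg_ex; exists d.
exact: cvg_lim c.
Qed.

(** A form without quotients: it allows [h = 0] and suits increments that are known through the mean
    value theorem or through [|h|]. *)
Lemma is_derive_eps (R : realType) (f : R -> R) (x d : R) :
  (forall e : R, 0 < e -> exists2 r : R, 0 < r & forall h, `|h| < r ->
     `|f (x + h) - f x - h * d| <= e * `|h|) -> is_derive x 1 f d.
Proof.
move=> H; apply: cvg_is_derive; apply/cvgrPdist_le => e e0.
have [r r0 Hr] := H e e0.
near=> h.
have h0 : h != 0 by near: h; exact: nbhs_dnbhs_neq.
have hr : `|h| < r.
  near: h; apply: dnbhs0_lt; exact: r0.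
have := Hr h hr.
have -> : d - h^-1 * (f (x + h) - f x) = - h^-1 * (f (x + h) - f x - h * d).
  by field.
rewrite normrM normrN normfV => Hh.
by rewrite ler_pdivrMl ?normr_gt0 // [leRHS]mulrC.
Unshelve. all: by end_near. Qed.

Lemma is_derive_cont (R : realType) (f : R -> R) (x d : R) :
  is_derive x 1 f d -> {for x, continuous f}.
Proof. by move=> [+ _]; move/derivable1_diffP/differentiable_continuous. Qed.

Lemma MVT_line (R : realType) (f df : R -> R) (a : R) :
  (forall s : R, `|s| <= `|a| -> is_derive s 1 f (df s)) ->
  exists2 c, `|c| <= `|a| & f a - f 0 = df c * a.
Proof.
move=> H; have [a0|a0|->] := ltgtP a 0; last first.
- by exists 0; rewrite ?normr0// subrr mulr0.
- have [||c] := @MVT R f df 0 a a0.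
  + move=> s; rewrite in_itv/= => /andP[s0 sa]; apply: H.
    by rewrite !gtr0_norm// ltW.
  + apply: derivable_within_continuous => s; rewrite in_itv/= => /andP[s0 sa].
    apply: ex_derive; apply: H; rewrite !ger0_norm //; exact: ltW.
  + rewrite in_itv/= subr0 => /andP[c0 ca] ->; exists c => //.
    by rewrite !gtr0_norm// ltW.
- have [||c] := @MVT R f df a 0 a0.
  + move=> s; rewrite in_itv/= => /andP[s0 sa]; apply: H.
    by rewrite !ltr0_norm// lerN2 ltW.
  + apply: derivable_within_continuous => s; rewrite in_itv/= => /andP[s0 sa].
    apply: ex_derive; apply: H; rewrite !ler0_norm ?lerN2 //; exact: ltW.
  + rewrite in_itv/= => /andP[c0 ca] E; exists c => //.
      by rewrite !ltr0_norm// lerN2 ltW.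
    by rewrite -opprB E sub0r mulrN opprK.
Qed.

(** If [c] were positive, [k1] would be positive just to the right of [0], and the mean value
    theorem would make [k] exceed [k 0] there. *)
Lemma second_derivative_max (R : realType) (k k1 : R -> R) (c : R) :
  (\forall t \near (0 : R), is_derive t (1 : R) k (k1 t)) -> is_derive (0 : R) 1 k1 c ->
  (\forall t \near (0 : R), k t <= k 0) -> k1 0 = 0 /\ c <= 0.
Proof.
move=> /nbhs_ballP[r r0 Hr] dk1 /nbhs_ballP[r' r'0 Hm].
pose d := Num.min r r'.
have d0 : 0 < d by rewrite lt_min r0.
have dk (t : R) : `|t| < d -> is_derive t 1 k (k1 t).
  move=> td; apply: Hr; rewrite -ball_normE /ball_/= sub0r normrN.
  by apply: lt_le_trans td _; rewrite ge_min lexx.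
have km t : `|t| < d -> k t <= k 0.
  move=> td; apply: Hm; rewrite -ball_normE /ball_/= sub0r normrN.
  by apply: lt_le_trans td _; rewrite ge_min lexx orbT.
have k10 : k1 0 = 0.
  have [] := @derive1_at_max R k (- d) d 0; rewrite ?in_itv/=.
  - lra.
  - by move=> t; rewrite in_itv/= -ltr_norml => td; apply: ex_derive; apply: dk.
  - by rewrite oppr_lt0 d0.
  - by move=> t; rewrite in_itv/= -ltr_norml; exact: km.
  move=> _ E; have [] := dk 0; first by rewrite normr0.
  by rewrite E.
split=> //; rewrite leNgt; apply/negP => c0.
have /cvgrPdist_lt /(_ (c / 2)) := is_derive_cvg dk1.
have c20 : 0 < c / 2 by lra.
move=> /(_ c20) /nbhs_ballP[s s0 Hs].
pose t := Num.min d s / 2.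
have m0 : 0 < Num.min d s by rewrite lt_min d0.
have t0 : 0 < t by rewrite /t; lra.
have td : t < d.
  have : Num.min d s <= d by rewrite ge_min lexx.
  rewrite /t; lra.
have ts : t < s.
  have : Num.min d s <= s by rewrite ge_min lexx orbT.
  rewrite /t; lra.
have [||x] := @MVT R k k1 0 t t0.
- move=> x; rewrite in_itv/= => /andP[x0 xt]; apply: dk.
  by rewrite gtr0_norm// (lt_trans xt).
- apply: derivable_within_continuous => x; rewrite in_itv/= => /andP[x0 xt].
  by apply: ex_derive; apply: dk; rewrite ger0_norm// (le_lt_trans xt).
rewrite in_itv/= subr0 => /andP[x0 xt] E.
have := km t; rewrite gtr0_norm// => /(_ td).
rewrite -subr_le0 E pmulr_lle0// leNgt => /negP; apply.
have := Hs x; rewrite -ball_normE /ball_/= sub0r normrN gtr0_norm//.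
move=> /(_ (lt_trans xt ts)) /(_ (lt0r_neq0 x0)).
rewrite add0r k10 subr0 => /(le_lt_trans (ler_norm _)) H.
have : 0 < x^-1 * k1 x by lra.
by rewrite pmulr_rgt0// invr_gt0.
Qed.

(** * Bounds on compact sets and continuity at a point *)

Lemma compact_ub (R : realType) (T : topologicalType) (A : set T) (f : T -> R) :
  compact A -> (forall x, A x -> {for x, continuous f}) ->
  exists M, forall x, A x -> f x <= M.
Proof.
move=> cA cf; have [A0|/set0P/negP/negPn/eqP A0] := pselect (A !=set0); last first.
  by exists 0 => x; rewrite A0.
have cf' : {within A, continuous f}.
  by apply: continuous_in_subspaceT => x /set_mem; exact: cf.
have [c _ H] := compact_EVT_max A0 cA cf'.
by exists (f c) => x Ax; apply: H; exact: mem_set.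
Qed.

Lemma compact_pos_lb (R : realType) (T : topologicalType) (A : set T) (f : T -> R) :
  compact A -> (forall x, A x -> {for x, continuous f}) ->
  (forall x, A x -> 0 < f x) ->
  exists2 m, 0 < m & forall x, A x -> m <= f x.
Proof.
move=> cA cf fp; have [A0|/set0P/negP/negPn/eqP A0] := pselect (A !=set0); last first.
  by exists 1 => // x; rewrite A0.
have cf' : {within A, continuous f}.
  by apply: continuous_in_subspaceT => x /set_mem; exact: cf.
have [c /set_mem Ac H] := compact_EVT_min A0 cA cf'.
by exists (f c) => [|x Ax]; [exact: fp | apply: H; exact: mem_set].
Qed.

Section PointwiseContinuity.
Variables (R : realType) (T : topologicalType) (x : T).
Implicit Types f g : T -> R.

Lemma continuous_at_cst (c : R) : {for x, continuous (fun _ : T => c)}.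
Proof. exact: cvg_cst. Qed.

Lemma continuous_at_add f g : {for x, continuous f} -> {for x, continuous g} ->
  {for x, continuous (fun y => f y + g y)}.
Proof. exact: cvgD. Qed.

Lemma continuous_at_sub f g : {for x, continuous f} -> {for x, continuous g} ->
  {for x, continuous (fun y => f y - g y)}.
Proof. exact: cvgB. Qed.

Lemma continuous_at_mul f g : {for x, continuous f} -> {for x, continuous g} ->
  {for x, continuous (fun y => f y * g y)}.
Proof. exact: cvgM. Qed.

Lemma continuous_at_comp (k : R -> R) f : {for x, continuous f} ->
  {for f x, continuous k} -> {for x, continuous (fun y => k (f y))}.
Proof. by move=> cf ck; exact: (continuous_comp cf ck). Qed.

Lemma continuous_at_max f g : {for x, continuous f} -> {for x, continuous g} ->
  {for x, continuous (fun y => Num.max (f y) (g y))}.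
Proof. exact: continuous_max. Qed.

Lemma continuous_at_inv f : f x != 0 -> {for x, continuous f} ->
  {for x, continuous (fun y => (f y)^-1)}.
Proof. by move=> fx cf; exact: cvgV. Qed.

Lemma continuous_at_lt f (c : R) : {for x, continuous f} -> f x < c ->
  \forall y \near x, f y < c.
Proof.
move=> cf cfx; apply: (cf [set s | s < c]).
by apply: open_nbhs_nbhs; split => //; exact: open_lt.
Qed.

End PointwiseContinuity.

(** * Second order jets in Euclidean space *)

Section EuclideanCalculus.
Variables (R : realType) (n : nat).
Local Notation V := 'rV[R]_n.
Local Notation "'e_ i" := (ebasis R i) (at level 8, i at level 2).
Implicit Types (g : V -> R) (x y v w : V) (M : V -> 'M[R]_n).

Definition dot v w : R := \sum_i v 0 i * w 0 i.

Lemma dotC v w : dot v w = dot w v.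
Proof. by apply: eq_bigr => i _; rewrite mulrC. Qed.

Lemma dotDl v w y : dot (v + w) y = dot v y + dot w y.
Proof. by rewrite /dot -big_split/=; apply: eq_bigr => i _; rewrite mxE mulrDl. Qed.

Lemma dotZl (c : R) v w : dot (c *: v) w = c * dot v w.
Proof. by rewrite /dot mulr_sumr; apply: eq_bigr => i _; rewrite mxE mulrA. Qed.

Lemma dotDr v w y : dot y (v + w) = dot y v + dot y w.
Proof. by rewrite dotC dotDl !(dotC y). Qed.

Lemma dotZr (c : R) v w : dot w (c *: v) = c * dot w v.
Proof. by rewrite dotC dotZl (dotC w). Qed.

Lemma dotNl v w : dot (- v) w = - dot v w.
Proof. by rewrite -scaleN1r dotZl mulN1r. Qed.

Lemma dotNr v w : dot v (- w) = - dot v w.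
Proof. by rewrite dotC dotNl dotC. Qed.

Lemma dotBl v w y : dot (v - w) y = dot v y - dot w y.
Proof. by rewrite dotDl dotNl. Qed.

Lemma dotBr v w y : dot y (v - w) = dot y v - dot y w.
Proof. by rewrite dotDr dotNr. Qed.

Lemma dotvv_ge0 v : 0 <= dot v v.
Proof. by apply: sumr_ge0 => i _; rewrite -expr2 sqr_ge0. Qed.

Lemma dot_ebasis v i : dot v 'e_i = v 0 i.
Proof.
rewrite /dot (bigD1 i)//= mxE !eqxx mulr1 big1 ?addr0// => j ji.
by rewrite mxE eqxx (negbTE ji) mulr0.
Qed.

Lemma ebasis_sum v : v = \sum_i v 0 i *: 'e_i.
Proof. exact: row_sum_delta. Qed.

Lemma enormE v : enorm v = Num.sqrt (dot v v).
Proof. by rewrite /enorm /dot; congr Num.sqrt; apply: eq_bigr => i _; rewrite expr2. Qed.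

Lemma enorm_ge0 v : 0 <= enorm v.
Proof. exact: sqrtr_ge0. Qed.

Lemma enorm_sqr v : enorm v ^+ 2 = dot v v.
Proof. by rewrite enormE sqr_sqrtr// dotvv_ge0. Qed.

Lemma enormZ (c : R) v : enorm (c *: v) = `|c| * enorm v.
Proof.
by rewrite !enormE dotZl dotZr mulrA -expr2 sqrtrM ?sqr_ge0// sqrtr_sqr.
Qed.

Lemma enormN v : enorm (- v) = enorm v.
Proof. by rewrite -scaleN1r enormZ normrN1 mul1r. Qed.

Lemma enorm_eq0 v : enorm v = 0 -> v = 0.
Proof.
move=> H; have : dot v v == 0 by rewrite -enorm_sqr H expr0n.
rewrite psumr_eq0 => [/allP H0|i _]; last by rewrite -expr2 sqr_ge0.
apply/rowP => i; have := H0 i; rewrite mem_index_enum => /(_ isT) /=.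
by rewrite mulf_eq0 orbb mxE => /eqP.
Qed.

Definition grad g x : V := \row_i 'D_('e_i) g x.
Definition hessmx g x : 'M[R]_n := \matrix_(i, j) 'D_('e_j) ('D_('e_i) g) x.

(** One step of the proof that continuous partial derivatives give a derivative in every direction.
    The base point [x + t a] moves together with the increment, so the mean value theorem in the
    coordinate [i] is combined with the continuity at [x] of that partial derivative. *)
Lemma is_derive_coordinate_step g i x a (c : R) :
  (\forall y \near x, derivable g y 'e_i) -> {for x, continuous ('D_('e_i) g)} ->
  is_derive (0 : R) 1 (fun t => g (x + t *: a + (t * c) *: 'e_i) - g (x + t *: a))
    (c * 'D_('e_i) g x).
Proof.
move=> /nbhs_ballP[r r0 Hr] cg; apply: is_derive_eps => e e0.
have c10 : 0 < `|c| + 1 by rewrite ltr_wpDl.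
have /cvgrPdist_le /(_ (e / (`|c| + 1)) (divr_gt0 e0 c10)) := cg.
move=> /nbhs_ballP[r' r'0 Hr'].
pose m := Num.min r r'.
have m0 : 0 < m by rewrite lt_min r0.
(* For [|h| < m / S] the whole segment of increments stays within [m] of [x]; the summand [1] keeps
   [S] positive. *)
pose S := `|a| + `|c| * `|'e_i| + 1.
have S0 : 0 < S by rewrite ltr_wpDl// addr_ge0// mulr_ge0.
exists (m / S); first by rewrite divr_gt0.
move=> h hm; rewrite add0r.
have near_pt (s : R) : `|s| <= `|h * c| -> ball x m (x + h *: a + s *: 'e_i).
  move=> sh; rewrite -ball_normE /ball_/= -addrA opprD addNKr normrN.
  apply: le_lt_trans (ler_normD _ _) _; rewrite !normrZ.
  apply: (@le_lt_trans _ _ (`|h| * S)); last by rewrite -ltr_pdivlMr.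
  rewrite /S !mulrDr mulr1 -addrA lerD2l.
  apply: (@le_trans _ _ (`|h| * (`|c| * `|'e_i|))).
    by rewrite mulrA -normrM ler_wpM2r.
  by rewrite lerDl.
have [|s sh E] := @MVT_line R (fun s => g (x + h *: a + s *: 'e_i))
  (fun s => 'D_('e_i) g (x + h *: a + s *: 'e_i)) (h * c); last first.
  rewrite scale0r addr0 in E; rewrite E !scale0r mul0r scale0r !addr0 subrr subr0.
  rewrite [X in `|X|](_ : _ =
    h * (c * ('D_('e_i) g (x + h *: a + s *: 'e_i) - 'D_('e_i) g x))); last by ring.
  rewrite normrM mulrC ler_wpM2r//.
  have := Hr' (x + h *: a + s *: 'e_i).
  have Hb : ball x r' (x + h *: a + s *: 'e_i).
    apply: le_ball (near_pt _ sh); by rewrite ge_min lexx orbT.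
  move=> /(_ Hb); rewrite distrC => H.
  rewrite normrM; apply: le_trans (ler_wpM2l (normr_ge0 c) H) _.
  rewrite mulrCA -[leRHS]mulr1 ler_wpM2l ?ltW// -[`|c|]/(`|c|).
  by rewrite ltr_pdivrMr ?mul1r ?ltrDl.
move=> s sh; apply/(is_derive_line g (x + h *: a) 'e_i s); apply: derivableP; apply: Hr.
apply: le_ball (near_pt _ sh); by rewrite ge_min lexx.
Qed.

Lemma is_derive_grad g x v :
  (forall i, (\forall y \near x, derivable g y 'e_i) /\
             {for x, continuous ('D_('e_i) g)}) ->
  is_derive x v g (dot (grad g x) v).
Proof.
move=> H; apply/(is_derive_line0 g x v).
(* The direction is built up one coordinate at a time, hence the claim for partial sums over an
   arbitrary list. *)
suff S (l : seq 'I_n) : is_derive (0 : R) 1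
    (fun t => g (x + t *: (\sum_(i <- l) v 0 i *: 'e_i)))
    (\sum_(i <- l) v 0 i * 'D_('e_i) g x).
  have := S (index_enum 'I_n); rewrite -ebasis_sum.
  rewrite (_ : \sum_(i <- _) _ = dot (grad g x) v)//.
  by apply: eq_bigr => i _; rewrite mxE mulrC.
elim: l => [|i l IH].
  rewrite !big_nil; under eq_fun do rewrite scaler0; exact: is_derive_cst.
rewrite !big_cons.
have [dg cg] := H i.
have := is_deriveD (is_derive_coordinate_step (\sum_(i <- l) v 0 i *: 'e_i)
  (v 0 i) dg cg) IH.
congr (is_derive _ _ _ _); apply/funext => t /=.
rewrite /GRing.add_fun/= subrK scalerDr scalerA -addrA.
by congr (g (_ + _)); rewrite addrC.
Qed.

(* The bilinear form [M] need not be symmetric. *)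
Definition jet2_on (O : set V) g (g1 : V -> V) M : Prop :=
  forall x, O x -> forall v, is_derive x v g (dot (g1 x) v) /\
    is_derive x v (fun y => dot (g1 y) v) (dot (v *m M x) v).

Lemma Ck_on_grad g (O : set V) : open O -> Ck_on 1 O g ->
  forall x v, O x -> is_derive x v g (dot (grad g x) v).
Proof.
move=> oO Cg x v Ox; apply: is_derive_grad => i; split.
  near=> y; have [] := Cg [::] isT y; last by move=> _ /(_ isT i).
  near: y; exact: open_nbhs_nbhs.
by have [] := Cg [:: i] isT x Ox.
Unshelve. all: by end_near. Qed.

Lemma Ck_on_partial k g (O : set V) i : Ck_on k.+1 O g -> Ck_on k O ('D_('e_i) g).
Proof.
move=> Cg s sk x Ox.
have iterDE (l : seq 'I_n) : @Defs.iterD R n l ('D_('e_i) g) = @Defs.iterD R n (rcons l i) g.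
  by elim: l => //= j l ->.
by rewrite iterDE; have := Cg (rcons s i); rewrite size_rcons !ltnS => /(_ sk x Ox).
Qed.

Lemma Ck_on_le j k g (O : set V) : (j <= k)%N -> Ck_on k O g -> Ck_on j O g.
Proof.
move=> jk Cg s sj x Ox; have [c d] := Cg s (leq_trans sj jk) x Ox.
by split=> // sj'; apply: d; exact: leq_trans sj' jk.
Qed.

Lemma Ck_on_jet2 g (O : set V) : open O -> Ck_on 2 O g ->
  jet2_on O g (grad g) (hessmx g).
Proof.
move=> oO Cg x Ox v; split; first by apply: Ck_on_grad oO _ _ _ Ox; exact: Ck_on_le Cg.
rewrite (_ : (fun y => dot (grad g y) v) = \sum_i v 0 i *: 'D_('e_i) g); last first.
  apply/funext => y; rewrite fct_sumE; apply: eq_bigr => i _.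
  by rewrite mxE mulrC.
have D i : is_derive x v ('D_('e_i) g) (dot (grad ('D_('e_i) g) x) v).
  by apply: Ck_on_grad oO _ _ _ Ox; exact: Ck_on_partial.
apply: is_derive_eq.
rewrite /dot; under [RHS]eq_bigr do rewrite mxE mulr_suml.
rewrite exchange_big/=; apply: eq_bigr => i _.
rewrite [LHS]mulr_sumr; apply: eq_bigr => j _; rewrite !mxE; ring.
Qed.

Lemma laplacian_hessmx g x : laplacian g x = \tr (hessmx g x).
Proof. by apply: eq_bigr => i _; rewrite mxE. Qed.

End EuclideanCalculus.

(** * Operations on jets, and [E_g] as an increment of derivatives *)

Section Jets.
Variables (R : realType) (n : nat).
Local Notation V := 'rV[R]_n.
Local Notation "'e_ i" := (ebasis R i) (at level 8, i at level 2).
Implicit Types (g : V -> R) (x y v w : V) (M : V -> 'M[R]_n) (O : set V).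

Lemma is_derive_comp1 (F g : V -> R) (f : R -> R) x v (d D : R) :
  F = f \o g -> is_derive x v g d -> is_derive (g x) 1 f D ->
  is_derive x v F (D * d).
Proof.
move=> -> /is_derive_line0 dg df; apply/(is_derive_line0 (f \o g) x v).
apply: (@is_derive1_comp _ f (fun s => g (x + s *: v))) => //.
by rewrite scale0r addr0.
Qed.

Lemma is_derive_ln_comp g x v (d : R) :
  0 < g x -> is_derive x v g d -> is_derive x v (fun y => ln (g y)) ((g x)^-1 * d).
Proof.
move=> gx dg; apply: (is_derive_comp1 (f := @ln R) _ dg) => //; exact: is_derive1_ln.
Qed.

Lemma is_derive_inv_comp g x v (d : R) :
  0 < g x -> is_derive x v g d ->
  is_derive x v (fun y => (g y)^-1) (- (g x) ^- 2 * d).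
Proof.
move=> gx dg; have gx0 : g x != 0 by rewrite gt_eqF.
split; first exact: derivableV.
rewrite (@deriveV _ _ g)//; first by have [_ ->] := dg.
Qed.

Lemma jet2_on_eq O g h (g1 : V -> V) M : open O -> (forall x, O x -> g x = h x) ->
  jet2_on O g g1 M -> jet2_on O h g1 M.
Proof.
move=> oO gh J x Ox v; have [J1 J2] := J x Ox v; split => //.
apply: near_eq_is_derive J1; near=> y; apply: gh; near: y; exact: open_nbhs_nbhs.
Unshelve. all: by end_near. Qed.

Lemma jet2_on_sub O O' g (g1 : V -> V) M : O' `<=` O ->
  jet2_on O g g1 M -> jet2_on O' g g1 M.
Proof. by move=> s J x /s; exact: J. Qed.

Lemma jet2_on_add O g h (g1 h1 : V -> V) M N :
  jet2_on O g g1 M -> jet2_on O h h1 N ->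
  jet2_on O (fun x => g x + h x) (fun x => g1 x + h1 x) (fun x => M x + N x).
Proof.
move=> J K x Ox v; have [J1 J2] := J x Ox v; have [K1 K2] := K x Ox v; split.
  by rewrite dotDl; exact: is_deriveD.
rewrite mulmxDr dotDl; under eq_fun do rewrite dotDl; exact: is_deriveD.
Qed.

Lemma jet2_on_scale O g (g1 : V -> V) M (c : R) :
  jet2_on O g g1 M ->
  jet2_on O (fun x => c * g x) (fun x => c *: g1 x) (fun x => c *: M x).
Proof.
move=> J x Ox v; have [J1 J2] := J x Ox v; split.
  by rewrite dotZl; exact: is_deriveZ.
rewrite -scalemxAr dotZl; under eq_fun do rewrite dotZl; exact: is_deriveZ.
Qed.

Lemma jet2_on_cst O (c : R) : jet2_on O (fun=> c) (fun=> 0) (fun=> 0).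
Proof.
have d0 v : dot 0 v = 0 by rewrite -[0 as X in dot X _](scale0r 0) dotZl mul0r.
move=> x _ v; rewrite /= mulmx0 !d0; split; first exact: is_derive_cst.
exact: is_derive_cst.
Qed.

Lemma dot_outer v w y : dot (v *m (w^T *m y)) v = dot w v * dot y v.
Proof.
rewrite mulmxA.
have -> : v *m w^T = (dot w v)%:M.
  apply/matrixP => i j; rewrite !mxE !ord1 eqxx mulr1n dotC.
  by apply: eq_bigr => k _; rewrite mxE.
by rewrite mul_scalar_mx dotZl.
Qed.

Lemma jet2_on_ln O g (g1 : V -> V) M :
  (forall x, O x -> 0 < g x) -> jet2_on O g g1 M ->
  jet2_on O (fun x => ln (g x)) (fun x => (g x)^-1 *: g1 x)
   (fun x => (g x)^-1 *: M x - (g x) ^- 2 *: ((g1 x)^T *m g1 x)).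
Proof.
move=> gp J x Ox v; have [J1 J2] := J x Ox v; have gx := gp x Ox; split.
  by rewrite dotZl; exact: is_derive_ln_comp.
rewrite mulmxBr dotBl -!scalemxAr !dotZl dot_outer.
under eq_fun do rewrite dotZl.
apply: (is_derive_eq (is_deriveM (is_derive_inv_comp gx J1) J2)).
rewrite /GRing.scale/=; ring.
Qed.

Lemma mxtrace_outer v w : \tr (v^T *m w) = dot v w.
Proof.
rewrite mxtrace_mulC /mxtrace big_ord1 mxE dotC.
by apply: eq_bigr => i _; rewrite mxE.
Qed.

Lemma continuous_sumr (T : topologicalType) (I : Type) (l : seq I)
    (f : I -> T -> R) (t : T) :
  (forall i, {for t, continuous (f i)}) ->
  {for t, continuous (fun s => \sum_(i <- l) f i s)}.
Proof.
move=> cf; elim: l => [|i l IH].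
  have -> : (fun s => \sum_(i <- [::]) f i s) = cst 0.
    by apply/funext => s; rewrite big_nil.
  exact: cvg_cst.
have -> : (fun s => \sum_(j <- i :: l) f j s) =
    (fun s => f i s + \sum_(j <- l) f j s).
  by apply/funext => s; rewrite big_cons.
exact: cvgD (cf i) IH.
Qed.

Lemma continuous_dot (T : topologicalType) (f h : T -> V) (t : T) :
  {for t, continuous f} -> {for t, continuous h} ->
  {for t, continuous (fun s => dot (f s) (h s))}.
Proof.
move=> cf ch; rewrite /dot; apply: continuous_sumr => i; apply: cvgM.
  exact: (continuous_comp cf (@coord_continuous R 1 n 0 i (f t))).
exact: (continuous_comp ch (@coord_continuous R 1 n 0 i (h t))).
Qed.

Lemma continuous_enorm : continuous (@enorm R n).
Proof.
move=> x; rewrite (_ : @enorm R n = @Num.sqrt R \o (fun v => dot v v)).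
  by apply: continuous_comp; [exact: continuous_dot | exact: sqrt_continuous].
by apply/funext => v; exact: enormE.
Qed.

Lemma continuous_line x v : continuous (fun t : R => x + t *: v).
Proof.
move=> t; apply: cvgD; first exact: cvg_cst.
by apply: cvgZ; [exact: cvg_id | exact: cvg_cst].
Qed.

(** The topology of row vectors comes from the sup norm; this transfers Euclidean bounds to it. *)
Lemma normr_le_enorm x : `|x| <= enorm x.
Proof.
rewrite [leLHS]/Num.norm/= mx_normrE; apply/bigmax_leP; split; first exact: enorm_ge0.
move=> [i j] _ /=; rewrite [i]ord1 -sqrtr_sqr; apply: ler_wsqrtr.
by rewrite (bigD1 j)//= lerDl sumr_ge0// => k _; exact: sqr_ge0.
Qed.

Lemma closure_le O g (c : R) x : (forall y, O y -> g y <= c) ->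
  {for x, continuous g} -> closure O x -> g x <= c.
Proof.
move=> gc cg Ox; rewrite leNgt; apply/negP => cgx.
have /Ox[y [Oy]] : nbhs x [set y | c < g y].
  apply: (cg [set r | c < r]); apply: open_nbhs_nbhs; split => //; exact: open_gt.
by rewrite /= ltNge gc.
Qed.

Lemma compact_closure_bounded O :
  (exists M : R, forall x, O x -> enorm x <= M) -> compact (closure O).
Proof.
move=> [M HM]; apply: bounded_closed_compact; last exact: closed_closure.
have cl x : closure O x -> enorm x <= M.
  by move=> Ox; apply: closure_le HM _ Ox; exact: continuous_enorm.
exists M; split; first exact: num_real.
move=> M' MM' x /cl xM; apply: le_trans (normr_le_enorm x) _.
exact: le_trans xM (ltW MM').
Qed.

Lemma hess_dir_jet2 O g (g1 : V -> V) M x v : open O -> jet2_on O g g1 M -> O x ->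
  hess_dir g x v = dot (v *m M x) v.
Proof.
move=> oO J Ox; have [_ [d E]] := J x Ox v.
rewrite /hess_dir -E; apply: near_eq_derive => //; near=> y.
have Oy : O y by near: y; exact: open_nbhs_nbhs.
by have [[]] := J y Oy v.
Unshelve. all: by end_near. Qed.

Lemma rdist_gt0 x y : x != y -> 0 < rdist x y.
Proof.
move=> xy; rewrite lt_neqAle enorm_ge0 andbT eq_sym; apply: contra xy => /eqP.
by move/enorm_eq0/eqP; rewrite subr_eq0.
Qed.

Lemma theta_end x y : x != y -> theta (rdist x y) x y = y.
Proof.
move=> xy; rewrite /theta /Ndir scalerA mulfV ?gt_eqF ?rdist_gt0//.
by rewrite scale1r addrC subrK.
Qed.

(** Fundamental theorem of calculus along the segment. The boundary terms are what appears when
    [g (z + s e) + g (z - s e)] is differentiated in [s]. *)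
Lemma Eg_jet2 O g (g1 : V -> V) M x y : open O -> jet2_on O g g1 M ->
  (forall z v, O z -> {for z, continuous (fun z' => dot (v *m M z') v)}) ->
  x != y -> (forall s, 0 <= s <= rdist x y -> O (theta s x y)) ->
  Eg g x y = dot (g1 y) (Ndir x y) - dot (g1 x) (Ndir x y).
Proof.
move=> oO J cM xy seg; rewrite /Eg (negbTE xy).
set N := Ndir x y; set r := rdist x y.
have r0 : 0 < r by exact: rdist_gt0.
pose F s := dot (g1 (x + s *: N)) N.
pose f s := dot (N *m M (x + s *: N)) N.
have dF s : 0 <= s <= r -> is_derive s 1 F (f s).
  move=> /seg Os; apply/(is_derive_line (fun z => dot (g1 z) N) x N s).
  by have [] := J _ Os N.
have cf s : 0 <= s <= r -> {for s, continuous f}.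
  move=> /seg Os; exact: (@continuous_comp _ _ _ (fun s : R => x + s *: N)
    (fun z => dot (N *m M z) N) s (@continuous_line x N s) (cM _ N Os)).
rewrite (_ : (\int[_]_(s in _) _)%R = \int[lebesgue_measure]_(s in `[0, r]) f s); last first.
  apply: eq_Rintegral => s /set_mem; rewrite /= in_itv/= => /seg Os.
  exact: hess_dir_jet2 oO J Os.
rewrite /Rintegral (@continuous_FTC2 _ f F)//.
- rewrite /= /F scale0r addr0; congr (dot (g1 _) _ - _); exact: theta_end.
- apply: continuous_in_subspaceT => s /set_mem; rewrite /= in_itv/=; exact: cf.
- split.
  + move=> s; rewrite in_itv/= => /andP[s0 sr]; apply: ex_derive; apply: dF.
    by rewrite !ltW.
  + apply: cvg_at_right_filter; apply: is_derive_cont; apply: dF.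
    by rewrite lexx ltW.
  + apply: cvg_at_left_filter; apply: is_derive_cont; apply: dF.
    by rewrite lexx ltW.
- move=> s; rewrite in_itv/= => /andP[s0 sr]; rewrite derive1E.
  by have [] := dF s; rewrite ?(ltW s0) ?(ltW sr).
Qed.

End Jets.

(** * The four-point maximum principle *)

(** Differentiability is given at [0] only, so the contradiction is read off the difference
    quotient: a small step [t] with the sign of [d] would increase [k]. *)
Lemma derivative_local_max (R : realType) (k : R -> R) (d : R) :
  is_derive (0 : R) 1 k d -> (\forall t \near (0 : R), k t <= k 0) -> d = 0.
Proof.
move=> dk /nbhs_ballP[r r0 Hm].
have km (t : R) : `|t| < r -> k t <= k 0.
  by move=> tr; apply: Hm; rewrite -ball_normE /ball_/= sub0r normrN.
have /cvgrPdist_lt cv := is_derive_cvg dk.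
apply/eqP/negPn/negP => d0; have := cv `|d|.
rewrite normr_gt0 => /(_ d0) /nbhs_ballP[s s0 Hs].
pose t := Num.min r s / 2 * Num.sg d.
have m0 : 0 < Num.min r s by rewrite lt_min r0.
have sd : `|Num.sg d| = 1 by rewrite normr_sg d0.
have tE : `|t| = Num.min r s / 2.
  rewrite /t normrM sd mulr1 gtr0_norm//; lra.
have tr : `|t| < r.
  have : Num.min r s <= r by rewrite ge_min lexx.
  rewrite tE; lra.
have ts : `|t| < s.
  have : Num.min r s <= s by rewrite ge_min lexx orbT.
  rewrite tE; lra.
have t0 : t != 0 by rewrite -normr_gt0 tE; lra.
have := Hs t; rewrite -ball_normE /ball_/= sub0r normrN => /(_ ts t0).
rewrite add0r; set Q := t^-1 * _.
have Qd : Q * Num.sg d <= 0.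
  have -> : Q * Num.sg d = (k t - k 0) * (2 / Num.min r s).
    rewrite /Q /t invfM; have := sd; case: sgrP d0 => // _ _ _; field; rewrite gt_eqF//.
  by rewrite mulr_le0_ge0 ?subr_le0 ?km// divr_ge0// ltW.
rewrite -[`|d - Q|]mulr1 -sd -normrM => H.
have := le_lt_trans (ler_norm _) H; rewrite mulrBl [d * _]mulrC -normrEsg.
lra.
Qed.

Lemma is_derive_affine (R : realType) (F : R -> R) (b c h D : R) :
  is_derive (b + h * c) 1 F D -> is_derive h 1 (fun s => F (b + s * c)) (D * c).
Proof.
move=> dF; apply: (@is_derive1_comp _ F (fun s => b + s * c)) => //.
have := is_deriveD (is_derive_cst b h 1) (is_deriveZ c (is_derive_id h 1)).
rewrite add0r [c *: 1]mulr1; congr (is_derive _ _ _ _); apply/funext => s.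
by rewrite /= mulrC.
Qed.

Section FourPointMaximum.
Variables (R : realType) (n : nat).
Local Notation V := 'rV[R]_n.
Local Notation "'e_ i" := (ebasis R i) (at level 8, i at level 2).
Implicit Types (x y v : V) (t : R).

(** The point at signed distance [t b] from the midpoint towards [x], where [b] is half the
    distance. With [t] instead of [a = t b] as coordinate, the configurations form a product set
    that includes [x = y]. *)
Definition inner t x y : V := ((1 + t) / 2) *: x + ((1 - t) / 2) *: y.

Lemma inner_line t x y v w (h : R) :
  inner t (x + h *: v) (y + h *: w) = inner t x y + h *: inner t v w.
Proof. by apply/rowP => i; rewrite !mxE; ring. Qed.

Lemma dot_line_sqr x v (h : R) :
  dot (x + h *: v) (x + h *: v) = dot x x + (2 * dot x v) * h + dot v v * h ^+ 2.
Proof. by rewrite !dotDl !dotDr !dotZl !dotZr (dotC v x); ring. Qed.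

Lemma dot_mulmx_ebasis (M : 'M[R]_n) i : dot ('e_i *m M) 'e_i = M i i.
Proof. by rewrite dot_ebasis -rowE mxE. Qed.

Lemma dot_mxE v w : dot v w = (v *m w^T) 0 0.
Proof. by rewrite mxE; apply: eq_bigr => i _; rewrite mxE. Qed.

(** The vectors are the rows of the reflection [S = 1 - 2 e^T e]. It is a symmetric involution, so
    the sum is the trace of [S M S], which is that of [M S S = M]. *)
Lemma mxtrace_reflection (M : 'M[R]_n) e : dot e e = 1 ->
  \sum_i dot (('e_i - (2 * dot 'e_i e) *: e) *m M) ('e_i - (2 * dot 'e_i e) *: e)
  = \tr M.
Proof.
move=> ee; pose S : 'M[R]_n := 1%:M - 2 *: (e^T *m e).
have ee1 : e *m e^T = 1%:M.
  by apply/matrixP => i j; rewrite !ord1 -dot_mxE ee mxE eqxx.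
have ST : S^T = S.
  by rewrite /S linearB/= linearZ/= trmx_mul trmxK trmx1.
have SS : S *m S = 1%:M.
  have EE : e^T *m e *m (e^T *m e) = e^T *m e.
    by rewrite mulmxA -(mulmxA e^T) ee1 mulmx1.
  rewrite /S; move: (e^T *m e) EE => E EE.
  rewrite mulmxBl mul1mx mulmxBr mulmx1 -scalemxAl -scalemxAr EE scalerA.
  by apply/matrixP => i j; rewrite !mxE; ring.
have SE i : 'e_i - (2 * dot 'e_i e) *: e = 'e_i *m S.
  rewrite /S mulmxBr mulmx1 -scalemxAr mulmxA.
  have -> : 'e_i *m e^T = (dot 'e_i e)%:M.
    by apply/matrixP => a b; rewrite !ord1 -dot_mxE mxE eqxx.
  by rewrite mul_scalar_mx scalerA.
under eq_bigr => i _.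
  rewrite SE (_ : dot _ _ = (S *m M *m S) i i); last first.
    by rewrite -dot_mulmx_ebasis !dot_mxE trmx_mul ST !mulmxA.
  over.
rewrite -/(mxtrace _) mxtrace_mulC mulmxA SS mul1mx //.
Qed.

Variables (O : set V) (A B : V -> R) (A1 B1 : V -> V) (MA MB : V -> 'M[R]_n).
Variables (Xi w w1 : R -> R) (L : R).
Hypothesis oO : open O.
Hypotheses (JA : jet2_on O A A1 MA) (JB : jet2_on O B B1 MB).
Hypothesis dXi : forall s : R, `|s| < L -> is_derive s 1 Xi (w s).
Hypothesis dw : forall s : R, `|s| < L -> is_derive s 1 w (w1 s).

Definition four_point x y t :=
  A x + A y - B (inner t x y) - B (inner (- t) x y)
  + Xi (rdist x y / 2) - Xi (t * (rdist x y / 2)).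

Variables (x y : V) (t : R).
Hypotheses (Ox : O x) (Oy : O y) (Op : O (inner t x y)) (Op' : O (inner (- t) x y)).
Hypotheses (xy : x != y) (t1 : `|t| < 1).
Hypothesis bL : rdist x y / 2 < L.
Hypothesis maxi : forall x' y' t', O x' -> O y' -> `|t'| <= 1 ->
  four_point x' y' t' <= four_point x y t.

Let b := rdist x y / 2.
Let a := t * b.
Let e := (2 * b)^-1 *: (y - x).
Let p := inner t x y.
Let p' := inner (- t) x y.

Let b0 : 0 < b. Proof. by rewrite divr_gt0// rdist_gt0. Qed.
Let aL : `|a| < L.
Proof.
rewrite normrM (gtr0_norm b0); apply: le_lt_trans bL.
by rewrite ler_piMl// ltW.
Qed.
Let bL' : `|b| < L. Proof. by rewrite gtr0_norm. Qed.

Let nearO z v : O z -> \forall h \near (0 : R), O (z + h *: v).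
Proof.
move=> Oz; have := @continuous_line R n z v 0; apply.
by rewrite scale0r addr0; exact: open_nbhs_nbhs.
Qed.

Let ee : dot e e = 1.
Proof.
rewrite /e dotZl dotZr -opprB dotNl dotNr opprK -enorm_sqr -/(rdist x y).
have -> : rdist x y = 2 * b by rewrite /b; field.
by field; rewrite gt_eqF.
Qed.

(** Here [t] is fixed and the outer points move independently. The inner points follow linearly, the
    half distance changes at the rate [e . (u - v) / 2], and [a] changes at [t] times that rate. *)
Lemma four_point_critical v u :
  dot (A1 x) v + dot (A1 y) u - dot (B1 p) (inner t v u)
  - dot (B1 p') (inner (- t) v u)
  + (w b - t * w a) * (dot e (u - v) / 2) = 0.
Proof.
pose r (h : R) := rdist (x + h *: v) (y + h *: u) / 2.
have dr : is_derive (0 : R) 1 r (dot e (u - v) / 2).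
  (* The half distance is half the square root of a quadratic polynomial in [h], which is positive
     at [0] because [x != y]. *)
  pose z := x - y; pose d := v - u.
  pose f (h : R) := dot z z + (2 * dot z d) * h + dot d d * h ^+ 2.
  have rE : r = (fun h => 2^-1 *: Num.sqrt (f h)).
    apply/funext => h; rewrite /r /rdist.
    have -> : x + h *: v - (y + h *: u) = z + h *: d.
      by apply/rowP => i; rewrite !mxE; ring.
    rewrite enormE mulrC; congr (_ * Num.sqrt _).
    exact: dot_line_sqr.
  have df : is_derive (0 : R) 1 f (2 * dot z d).
    have D := is_deriveD (is_deriveD (is_derive_cst (dot z z) (0 : R) 1)
      (is_deriveZ (2 * dot z d) (is_derive_id (0 : R) 1)))
      (is_deriveZ (dot d d) (is_deriveX 2 (is_derive_id (0 : R) 1))).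
    have [D1 D2] := D; split; first exact: D1.
    by rewrite -[LHS]/(derive _ _ _) D2 /GRing.scale/=; ring.
  have zE : Num.sqrt (f 0) = 2 * b.
    by rewrite /f mulr0 expr0n mulr0 !addr0 -enormE /b /rdist mulrC divfK.
  have f0 : 0 < f 0 by rewrite -sqrtr_gt0 zE mulr_gt0.
  have ds := @is_derive1_comp _ Num.sqrt f 0 _ _ (is_derive1_sqrt f0) df.
  rewrite rE; apply: is_derive_eq (is_deriveZ 2^-1 ds) _.
  rewrite zE /e dotZl /GRing.scale/=.
  have -> : dot (y - x) (u - v) = dot z d.
    by rewrite -[y - x]opprB -[u - v]opprB dotNl dotNr opprK.
  by field; rewrite gt_eqF.
have r0 : r 0 = b by rewrite /r !scale0r !addr0.
pose k (h : R) := four_point (x + h *: v) (y + h *: u) t.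
apply: (@derivative_local_max R k).
  have kE : k = (fun h => A (x + h *: v)) + (fun h => A (y + h *: u))
      - (fun h => B (p + h *: inner t v u))
      - (fun h => B (p' + h *: inner (- t) v u)) + (Xi \o r)
      - ((fun s => Xi (0 + s * t)) \o r).
    apply/funext => h; rewrite /k /four_point !inner_line.
    rewrite -[RHS]/(A (x + h *: v) + A (y + h *: u) - B (p + h *: inner t v u)
      - B (p' + h *: inner (- t) v u) + Xi (r h) - Xi (0 + r h * t)).
    by rewrite add0r [r h * t]mulrC.
  have dA1 := (is_derive_line0 A x v _).1 (JA Ox v).1.
  have dA2 := (is_derive_line0 A y u _).1 (JA Oy u).1.
  have dB1 := (is_derive_line0 B p (inner t v u) _).1 (JB Op _).1.
  have dB2 := (is_derive_line0 B p' (inner (- t) v u) _).1 (JB Op' _).1.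
  have dX1 : is_derive (r 0) 1 Xi (w b) by rewrite r0; exact: dXi.
  have dX2 : is_derive (r 0) 1 (fun s => Xi (0 + s * t)) (w a * t).
    apply: is_derive_affine; rewrite r0 add0r mulrC; exact: dXi.
  have D1 := @is_derive1_comp _ Xi r 0 _ _ dX1 dr.
  have D2 := @is_derive1_comp _ _ r 0 _ _ dX2 dr.
  rewrite kE; apply: is_derive_eq
    (is_deriveB (is_deriveD (is_deriveB (is_deriveB (is_deriveD dA1 dA2) dB1) dB2) D1) D2) _.
  ring.
have := nearO v Ox; have := nearO u Oy; apply: filterS2 => h Oyh Oxh.
rewrite /k !scale0r !addr0; apply: maxi => //; exact: ltW.
Qed.

(** Varying [t] alone slides the inner points along [e] in opposite directions; as [|t| < 1], both
    signs of the variation are admissible. *)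
Lemma four_point_critical_t : dot (B1 p - B1 p') e = w a.
Proof.
pose k (h : R) := four_point x y (t + h).
pose d := b *: e.
have pE h : inner (t + h) x y = p + h *: (- d).
  by apply/rowP => i; rewrite !mxE; field; rewrite gt_eqF.
have pE' h : inner (- (t + h)) x y = p' + h *: d.
  by apply/rowP => i; rewrite !mxE; field; rewrite gt_eqF.
suff : - dot (B1 p) (- d) - dot (B1 p') d - w a * b = 0.
  rewrite dotNr /d !dotZr dotBl => H; apply: (mulfI (lt0r_neq0 b0)); lra.
apply: (@derivative_local_max R k).
  have kE : k = (fun=> A x + A y + Xi b) - (fun h => B (p + h *: (- d)))
      - (fun h => B (p' + h *: d)) - (fun h => Xi (a + h * b)).
    apply/funext => h; rewrite /k /four_point pE pE' -/b mulrDl -/a.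
    by rewrite -[RHS]/(_ - _ - _ - _); ring.
  have dB1 := (is_derive_line0 B p (- d) _).1 (JB Op _).1.
  have dB2 := (is_derive_line0 B p' d _).1 (JB Op' _).1.
  have dX : is_derive (0 : R) 1 (fun h => Xi (a + h * b)) (w a * b).
    by apply: is_derive_affine; rewrite mul0r addr0; exact: dXi.
  rewrite kE; apply: is_derive_eq
    (is_deriveB (is_deriveB (is_deriveB (is_derive_cst _ _ _) dB1) dB2) dX) _.
  by rewrite sub0r.
apply/nbhs_ballP; exists (1 - `|t|); first by rewrite /= subr_gt0.
move=> h; rewrite -ball_normE /ball_/= sub0r normrN => ht.
rewrite /k addr0; apply: maxi => //.
apply: le_trans (ler_normD _ _) _; lra.
Qed.

(** By the parallelogram identity it suffices to compare sums and differences of gradients. Moving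
    [x] and [y] by the same vector shows that the sums agree. Moving them by opposite vectors gives
    [A1 x - A1 y = t Q + w b e], where [Q = B1 p - B1 p' - w a e] is orthogonal to [e] by the
    condition in [t]. The inequality then comes from [t^2 |Q|^2 <= |Q|^2]. *)
Lemma four_point_gradients :
  dot (A1 x) (A1 x) + dot (A1 y) (A1 y) - dot (B1 p) (B1 p) - dot (B1 p') (B1 p')
  <= (w b ^+ 2 - w a ^+ 2) / 2.
Proof.
have := four_point_critical_t; have := four_point_critical; have := ee.
move: (e) => e0 ee0 crit crit_t.
pose S := A1 x + A1 y - B1 p - B1 p'.
have ext z : (forall v, dot z v = 0) -> z = 0.
  by move=> H; apply/rowP => i; rewrite -dot_ebasis H mxE.
have S0 : S = 0.
  apply: ext => v; have := crit v v.
  have inn s : inner s v v = v by apply/rowP => i; rewrite !mxE; field.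
  rewrite !inn subrr -[0 as X in dot e0 X](scale0r 0) dotZr !mul0r mulr0 addr0.
  by rewrite /S !dotBl dotDl.
pose Q := B1 p - B1 p' - w a *: e0.
have D0 : A1 x - A1 y = t *: Q + w b *: e0.
  apply/eqP; rewrite -subr_eq0; apply/eqP; apply: ext => v.
  have := crit v (- v).
  have -> : inner t v (- v) = t *: v by apply/rowP => i; rewrite !mxE; field.
  have -> : inner (- t) v (- v) = (- t) *: v by apply/rowP => i; rewrite !mxE; field.
  have -> : - v - v = (- 2) *: v by apply/rowP => i; rewrite !mxE; ring.
  rewrite dotNr !dotZr /Q dotBl [dot (A1 x - A1 y) v]dotBl dotDl !dotZl !dotBl !dotZl.
  lra.
have Qe : dot Q e0 = 0.
  by rewrite /Q dotBl crit_t dotZl ee0 mulr1 subrr.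
have N1 : dot (A1 x - A1 y) (A1 x - A1 y) = t ^+ 2 * dot Q Q + w b ^+ 2.
  rewrite D0 dot_line_sqr !dotZl !dotZr Qe ee0; ring.
have N2 : dot (B1 p - B1 p') (B1 p - B1 p') = dot Q Q + w a ^+ 2.
  have -> : B1 p - B1 p' = Q + w a *: e0 by rewrite /Q subrK.
  rewrite dot_line_sqr Qe ee0; ring.
have N3 : dot (A1 x + A1 y) (A1 x + A1 y) = dot (B1 p + B1 p') (B1 p + B1 p').
  suff -> : A1 x + A1 y = B1 p + B1 p' by [].
  by apply/eqP; rewrite -subr_eq0 opprD addrA; apply/eqP.
have t2 : t ^+ 2 <= 1.
  by rewrite -real_normK ?num_real// expr_le1// ltW.
have := ler_wpM2r (dotvv_ge0 Q) t2; rewrite mul1r.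
move: N1 N2 N3; rewrite !dotBl !dotBr !dotDl !dotDr.
rewrite (dotC (A1 y)) (dotC (B1 p')).
lra.
Qed.

(* Moving [x] and [p] along [v], [y] and [p'] along [v'], keeps the four points on a
   line of direction [e]; both [a] and [b] decrease by [h c] at time [h]. *)
Lemma four_point_second v v' (c : R) : v' = v - (2 * c) *: e ->
  dot (v *m MA x) v + dot (v' *m MA y) v' - dot (v *m MB p) v
    - dot (v' *m MB p') v' + c ^+ 2 * (w1 b - w1 a) <= 0.
Proof.
move=> v'E.
pose k (h : R) := A (x + h *: v) + A (y + h *: v') - B (p + h *: v)
  - B (p' + h *: v') + Xi (b + h * - c) - Xi (a + h * - c).
pose k1 (h : R) := dot (A1 (x + h *: v)) v + dot (A1 (y + h *: v')) v'
  - dot (B1 (p + h *: v)) v - dot (B1 (p' + h *: v')) v'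
  + w (b + h * - c) * - c - w (a + h * - c) * - c.
have small (r s : R) : `|s| < r -> \forall h \near (0 : R), `|s + h * - c| < r.
  move=> sr; have cs : {for (0 : R), continuous (fun h : R => s + h * - c)}.
    by apply: cvgD; [exact: cvg_cst | apply: cvgM; [exact: cvg_id|exact: cvg_cst]].
  have cn : {for (0 : R), continuous (fun h : R => `|s + h * - c|)}.
    exact: cvg_norm cs.
  apply: (cn [set u | u < r]); apply: open_nbhs_nbhs; split; first exact: open_lt.
  by rewrite /= mul0r addr0.
have [] := @second_derivative_max R k k1
  (dot (v *m MA x) v + dot (v' *m MA y) v' - dot (v *m MB p) v
    - dot (v' *m MB p') v' + c ^+ 2 * (w1 b - w1 a)); last by [].
- near=> h.
  have Oxh : O (x + h *: v) by near: h; exact: nearO.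
  have Oyh : O (y + h *: v') by near: h; exact: nearO.
  have Oph : O (p + h *: v) by near: h; exact: nearO.
  have Oph' : O (p' + h *: v') by near: h; exact: nearO.
  have bh : `|b + h * - c| < L by near: h; exact: small.
  have ah : `|a + h * - c| < L by near: h; exact: small.
  have dA1 := (is_derive_line A x v h _).1 (JA Oxh v).1.
  have dA2 := (is_derive_line A y v' h _).1 (JA Oyh v').1.
  have dB1 := (is_derive_line B p v h _).1 (JB Oph v).1.
  have dB2 := (is_derive_line B p' v' h _).1 (JB Oph' v').1.
  exact: (is_deriveB (is_deriveD (is_deriveB (is_deriveB (is_deriveD dA1 dA2) dB1) dB2)
    (is_derive_affine (dXi bh))) (is_derive_affine (dXi ah))).
- have dA1 := (is_derive_line0 _ x v _).1 (JA Ox v).2.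
  have dA2 := (is_derive_line0 _ y v' _).1 (JA Oy v').2.
  have dB1 := (is_derive_line0 _ p v _).1 (JB Op v).2.
  have dB2 := (is_derive_line0 _ p' v' _).1 (JB Op' v').2.
  have dw' (s : R) : `|s| < L ->
      is_derive (0 : R) 1 (fun h => - c *: w (s + h * - c)) (- c *: (w1 s * - c)).
    move=> sL; apply: is_deriveZ; apply: is_derive_affine.
    by rewrite mul0r addr0; exact: dw.
  have k1E : k1 = (fun h => dot (A1 (x + h *: v)) v) + (fun h => dot (A1 (y + h *: v')) v')
     - (fun h => dot (B1 (p + h *: v)) v) - (fun h => dot (B1 (p' + h *: v')) v')
     + (fun h => - c *: w (b + h * - c)) - (fun h => - c *: w (a + h * - c)).
    apply/funext => h; rewrite /k1.
    rewrite -[RHS]/(_ + _ - _ - _ + - c * w (b + h * - c) - - c * w (a + h * - c)).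
    by rewrite ![- c * _]mulrC.
  rewrite k1E; apply: is_derive_eq
    (is_deriveB (is_deriveD (is_deriveB (is_deriveB (is_deriveD dA1 dA2) dB1) dB2)
    (dw' b bL')) (dw' a aL)) _.
  by rewrite /GRing.scale/=; ring.
- near=> h.
  have Oxh : O (x + h *: v) by near: h; exact: nearO.
  have Oyh : O (y + h *: v') by near: h; exact: nearO.
  have bh : 0 < b + h * - c.
    have : `|0 + h * - c| < b by near: h; apply: small; rewrite normr0.
    by rewrite add0r ltr_norml => /andP[H _]; lra.
  have abh : `|a + h * - c| <= b + h * - c.
    have : `|0 + h * - c| < (b - `|a|) / 2.
      near: h; apply: small; rewrite normr0 divr_gt0// subr_gt0 normrM (gtr0_norm b0).
      by rewrite gtr_pMl.
    rewrite add0r ltr_norml => /andP[H1 H2].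
    have := ler_norm a; have := ler_norm (- a); rewrite normrN => H3 H4.
    by rewrite ler_norml; apply/andP; split; lra.
  (* The moved points form a four-point configuration again. Since [|a| < b] is strict, its
     parameter stays in [[-1, 1]] for small [h]. *)
  pose th := (a + h * - c) / (b + h * - c).
  have th1 : `|th| <= 1.
    by rewrite normrM normfV (gtr0_norm bh) ler_pdivrMr// mul1r.
  have bhn : b - h * c != 0 by rewrite -mulrN gt_eqF.
  have bn : b != 0 by rewrite gt_eqF.
  have E1 : inner th (x + h *: v) (y + h *: v') = p + h *: v.
    by rewrite v'E; apply/rowP => i; rewrite !mxE /th /a; field; rewrite bn gt_eqF.
  have E2 : inner (- th) (x + h *: v) (y + h *: v') = p' + h *: v'.
    by rewrite v'E; apply/rowP => i; rewrite !mxE /th /a; field; rewrite bn gt_eqF.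
  have E3 : rdist (x + h *: v) (y + h *: v') / 2 = b + h * - c.
    rewrite /rdist; have -> : x + h *: v - (y + h *: v') = (- 2 * (b + h * - c)) *: e.
      by rewrite v'E; apply/rowP => i; rewrite !mxE; field.
    rewrite enormZ enormE ee sqrtr1 mulr1 normrM normrN (gtr0_norm bh).
    by rewrite ger0_norm//; field.
  have -> : k h = four_point (x + h *: v) (y + h *: v') th.
    rewrite /k /four_point E1 E2 E3 /th divfK// gt_eqF//.
  have -> : k 0 = four_point x y t.
    by rewrite /k /four_point !scale0r !mul0r !addr0.
  exact: maxi.
Unshelve. all: by end_near. Qed.

(** Sum the second order conditions over the basis with [c = 'e_i . e]: then [v'] is the mirror
    image of ['e_i], the reflection preserves traces, and the numbers [c^2] add up to
    [|e|^2 = 1]. *)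
Lemma four_point_laplacian :
  \tr (MA x) + \tr (MA y) - \tr (MB p) - \tr (MB p') + w1 b - w1 a <= 0.
Proof.
have H : \sum_i (dot ('e_i *m MA x) 'e_i
   + dot (('e_i - (2 * dot 'e_i e) *: e) *m MA y) ('e_i - (2 * dot 'e_i e) *: e)
   - dot ('e_i *m MB p) 'e_i
   - dot (('e_i - (2 * dot 'e_i e) *: e) *m MB p') ('e_i - (2 * dot 'e_i e) *: e)
   + dot 'e_i e ^+ 2 * (w1 b - w1 a)) <= 0.
  by apply: sumr_le0 => i _; exact: four_point_second erefl.
move: H; rewrite !big_split/= !sumrN !mxtrace_reflection ?ee// -mulr_suml.
have T (M : 'M[R]_n) : \sum_i dot ('e_i *m M) 'e_i = \tr M.
  by apply: eq_bigr => i _; exact: dot_mulmx_ebasis.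
rewrite !T.
have -> : \sum_i dot 'e_i e ^+ 2 = 1.
  by rewrite -ee; apply: eq_bigr => i _; rewrite dotC dot_ebasis expr2.
by rewrite mul1r; lra.
Qed.

End FourPointMaximum.

(** * Positivity of the eigenfunction *)

Section StrongMaximum.
Variables (R : realType) (n : nat).
Local Notation V := 'rV[R]_n.
Local Notation "'e_ i" := (ebasis R i) (at level 8, i at level 2).
Implicit Types (g : V -> R) (x y v : V) (M : V -> 'M[R]_n) (O : set V).

Lemma is_derive_exp_comp g x v (d : R) (k : nat) : is_derive x v g d ->
  is_derive x v (fun y => g y ^+ k.+1) (k.+1%:R * g x ^+ k * d).
Proof.
move=> dg; apply: (is_derive_comp1 (f := fun r => r ^+ k.+1) _ dg) => //.
split; first exact: exprn_derivable.
by rewrite exp_derive /GRing.scale/= mulr1.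
Qed.

Lemma jet2_on_exp O g (g1 : V -> V) M (m : nat) : jet2_on O g g1 M ->
  jet2_on O (fun x => g x ^+ m.+2) (fun x => (m.+2%:R * g x ^+ m.+1) *: g1 x)
   (fun x => (m.+2%:R * g x ^+ m.+1) *: M x
      + (m.+2%:R * m.+1%:R * g x ^+ m) *: ((g1 x)^T *m g1 x)).
Proof.
move=> J x Ox v; have [J1 J2] := J x Ox v; split.
  by rewrite dotZl; exact: is_derive_exp_comp.
rewrite mulmxDr dotDl -!scalemxAr !dotZl dot_outer.
under eq_fun do rewrite dotZl -mulrA.
have D := is_deriveM (is_derive_exp_comp m J1) J2.
apply: is_derive_eq (is_deriveZ m.+2%:R D) _.
rewrite /GRing.scale/=; ring.
Qed.

Lemma jet2_on_sqdist O (c : V) (r : R) :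
  jet2_on O (fun x => r - dot (x - c) (x - c)) (fun x => (-2) *: (x - c))
    (fun=> (-2)%:M).
Proof.
move=> x _ v; split; rewrite -/(dot _ _).
  apply/(is_derive_line0 _ x v).
  pose b := x - c.
  have E : (fun s : R => r - dot (x + s *: v - c) (x + s *: v - c)) =
     (fun s : R => r - (dot b b + (2 * dot b v) * s + dot v v * s ^+ 2)).
    by apply/funext => s; rewrite -dot_line_sqr /b addrAC.
  rewrite E dotZl -/b.
  have D := is_deriveB (is_derive_cst r (0 : R) 1)
     (is_deriveD (is_deriveD (is_derive_cst (dot b b) (0 : R) 1)
      (is_deriveZ (2 * dot b v) (is_derive_id (0 : R) 1)))
      (is_deriveZ (dot v v) (is_deriveX 2 (is_derive_id (0 : R) 1)))).
  have [D1 D2] := D; split; first exact: D1.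
  by rewrite -[LHS]/(derive _ _ _) D2 /GRing.scale/=; ring.
apply/(is_derive_line0 _ x v).
have -> : (fun s : R => dot (-2 *: (x + s *: v - c)) v) =
    (fun s : R => dot ((-2) *: (x - c)) v + s * ((-2) * dot v v)).
  apply/funext => s; rewrite (addrAC x) !dotZl (dotDl (x - c)) dotZl; ring.
have := is_derive_affine (F := id) (b := dot ((-2) *: (x - c)) v) (h := 0)
   (c := (-2) * dot v v) (is_derive_id _ _).
by rewrite mul1r mul_mx_scalar !dotZl.
Qed.

Lemma jet2_min_trace O g (g1 : V -> V) M x : open O -> jet2_on O g g1 M -> O x ->
  (\forall y \near x, g x <= g y) -> 0 <= \tr (M x).
Proof.
move=> oO J Ox minx; apply: sumr_ge0 => i _.
rewrite -dot_mulmx_ebasis -oppr_le0.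
have nearline (P : set V) : nbhs x P -> \forall h \near (0 : R), P (x + h *: 'e_i).
  move=> Px; have := @continuous_line R n x 'e_i 0; apply.
  by rewrite scale0r addr0.
have [] := @second_derivative_max R (fun h => - g (x + h *: 'e_i))
  (fun h => - dot (g1 (x + h *: 'e_i)) 'e_i) (- dot ('e_i *m M x) 'e_i); last by [].
- near=> h; apply: is_deriveN; apply/(is_derive_line g x 'e_i h).
  have Oh : O (x + h *: 'e_i) by near: h; apply: (nearline O); exact: open_nbhs_nbhs.
  exact: (J _ Oh 'e_i).1.
- apply: is_deriveN; apply/(is_derive_line0 (fun y => dot (g1 y) 'e_i) x 'e_i).
  exact: (J _ Ox 'e_i).2.
- near=> h; rewrite scale0r addr0 lerN2; near: h; exact: (nearline [set y | g x <= g y]).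
Unshelve. all: by end_near. Qed.

Lemma continuous_sqdist (c x : V) : {for x, continuous (fun y => dot (y - c) (y - c))}.
Proof.
have cB : {for x, continuous (fun y => y - c)}.
  by apply: (@cvgB _ _ _ (nbhs x) _ id (fun=> c) x c); [exact: cvg_id | exact: cvg_cst].
exact: continuous_dot.
Qed.

Lemma compact_euclidean_ball (c : V) (r : R) :
  compact [set x | dot (x - c) (x - c) <= r ^+ 2].
Proof.
apply: bounded_closed_compact.
  exists (`|c| + `|r|); split; first exact: num_real.
  move=> K rK x /= xr; apply: le_trans (ltW rK).
  rewrite -[x](subrK c) addrC; apply: le_trans (ler_normD _ _) _.
  rewrite lerD2l; apply: le_trans (normr_le_enorm _) _.
  by rewrite enormE -sqrtr_sqr; apply: ler_wsqrtr.
apply: (@preimage_closed _ _ (fun x => dot (x - c) (x - c)) [set s | s <= r ^+ 2]).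
  by move=> x _; exact: continuous_sqdist.
exact: closed_le.
Qed.

(* The comparison function is [(r^2 - |x - c|^2)^k], whose Laplacian beats [C]
   times its value away from the centre once [k] is large. *)
Lemma ball_positivity O g (g1 : V -> V) M (C : R) (c : V) (r : R) :
  open O -> jet2_on O g g1 M -> 0 <= C ->
  (forall x, O x -> {for x, continuous g}) ->
  (forall x, O x -> 0 <= g x) -> (forall x, O x -> \tr (M x) <= C * g x) ->
  0 < r -> (forall x, dot (x - c) (x - c) <= r ^+ 2 -> O x) -> 0 < g c ->
  forall x, dot (x - c) (x - c) < r ^+ 2 -> 0 < g x.
Proof.
move=> oO J C0 cg g0 Mg r0 ballO gc.
have Oc : O c by apply: ballO; rewrite subrr -[0 as X in dot X _](scale0r 0) dotZl mul0r sqr_ge0.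
have [d d0 Hd] : exists2 d : R, 0 < d & forall x, `|x - c| < d -> g c / 2 < g x.
  have gc2 : g c / 2 < g c by lra.
  have /nbhs_ballP[d d0 Hd] : nbhs c [set x | g c / 2 < g x].
    apply: (cg c Oc [set s | g c / 2 < s]).
    apply: open_nbhs_nbhs; split => //; exact: open_gt.
  by exists d => // x xd; apply: Hd; rewrite -ball_normE /ball_/= distrC.
pose s := Num.min d r / 2.
have mr0 : 0 < Num.min d r by rewrite lt_min d0.
have s0 : 0 < s by rewrite /s; lra.
have sd : s < d.
  have : Num.min d r <= d by rewrite ge_min lexx.
  by rewrite /s; lra.
have Hs x : dot (x - c) (x - c) <= s ^+ 2 -> g c / 2 < g x.
  move=> xs; apply: Hd; apply: le_lt_trans sd; apply: le_trans (normr_le_enorm _) _.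
  by rewrite enormE -[leRHS](ger0_norm (ltW s0)) -sqrtr_sqr; apply: ler_wsqrtr.
(* The Laplacian of [D^(m+2)] is [(m+2) D^m (4 (m+1) |x - c|^2 - 2 n D)]. This [m] makes it exceed
   [C D^(m+2)] where [|x - c| > s] and [0 < D <= r^2]. *)
have [m Hm] : exists m : nat, 2 * n%:R * r ^+ 2 + C * r ^+ 4 < 4 * s ^+ 2 * m.+1%:R.
  have ss : 0 < 4 * s ^+ 2 by rewrite mulr_gt0// exprn_gt0.
  exists (Num.truncn ((2 * n%:R * r ^+ 2 + C * r ^+ 4) / (4 * s ^+ 2))).
  rewrite [ltRHS]mulrC -ltr_pdivrMr//; exact: truncnS_gt.
pose D x := r ^+ 2 - dot (x - c) (x - c).
pose K : R := r ^+ 2 ^+ m.+2.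
have K0 : 0 < K by rewrite /K !exprn_gt0.
(* [K] is the largest value of [D^(m+2)], so within distance [s] of [c] the subtracted term is at
   most [g c / 2], which is below [g]. *)
pose eps := g c / (2 * K).
have eps0 : 0 < eps by rewrite /eps divr_gt0// mulr_gt0.
pose G x := g x + (- eps) * D x ^+ m.+2.
have JG := jet2_on_add J (jet2_on_scale (- eps) (jet2_on_exp m (@jet2_on_sqdist O c (r ^+ 2)))).
suff H : forall x, dot (x - c) (x - c) <= r ^+ 2 -> 0 <= G x.
  move=> x xr; have := H x (ltW xr); rewrite /G.
  have : 0 < eps * D x ^+ m.+2 by rewrite mulr_gt0// exprn_gt0// subr_gt0.
  lra.
have Bc := @compact_euclidean_ball c r.
have cG x : dot (x - c) (x - c) <= r ^+ 2 -> {for x, continuous G}.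
  move=> xr; apply: continuous_at_add; first exact: cg (ballO _ xr).
  apply: continuous_at_mul; first exact: continuous_at_cst.
  apply: (@continuous_at_comp _ _ _ (fun s => s ^+ m.+2) D);
    last exact: exprn_continuous.
  by apply: continuous_at_sub; [exact: continuous_at_cst|exact: continuous_sqdist].
have B0 : [set x | dot (x - c) (x - c) <= r ^+ 2] !=set0.
  by exists c; rewrite /= subrr -[0 as X in dot X _](scale0r 0) dotZl mul0r sqr_ge0.
have cG' : {within [set x | dot (x - c) (x - c) <= r ^+ 2], continuous G}.
  by apply: continuous_in_subspaceT => x /set_mem; exact: cG.
have [z /set_mem /= Bz minz] := compact_EVT_min B0 Bc cG'.
move=> x xr; apply: le_trans (minz x (mem_set xr)).
(* A negative minimum of [G] lies neither on the sphere, where [D = 0], nor within distance [s] of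
   [c]. Elsewhere [G z < 0] bounds [C g] by [eps C D^(m+2)], so the trace for [G] would be negative
   at a minimum. *)
rewrite leNgt; apply/negP => Gz.
have Oz := ballO z Bz.
have Dz : 0 < D z.
  rewrite lt_neqAle subr_ge0 Bz andbT; apply/negP => /eqP Dz0.
  by move: Gz; rewrite /G -Dz0 expr0n mulr0 addr0 ltNge g0.
have DK : D z <= r ^+ 2 by rewrite /D lerBlDr lerDl dotvv_ge0.
have sz : s ^+ 2 < dot (z - c) (z - c).
  rewrite ltNge; apply/negP => /Hs gz.
  have : eps * D z ^+ m.+2 <= eps * K.
    by rewrite ler_wpM2l ?(ltW eps0)// /K lerXn2r// nnegrE ?ltW// exprn_gt0.
  have -> : eps * K = g c / 2 by rewrite /eps; field; rewrite gt_eqF.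
  by move: Gz; rewrite /G; lra.
have := @jet2_min_trace O G _ _ z oO JG Oz.
have near_min : \forall y \near z, G z <= G y.
  have : nbhs z [set y | dot (y - c) (y - c) < r ^+ 2].
    by apply: continuous_at_lt (@continuous_sqdist c z) _; rewrite -subr_gt0.
  by apply: filterS => y /ltW yr; apply: minz; exact: mem_set.
move=> /(_ near_min).
rewrite mxtraceD !mxtraceZ mxtraceD !mxtraceZ mxtrace_scalar mxtrace_outer dotZl dotZr.
have trM := Mg z Oz.
rewrite -/(D z).
set q := dot (z - c) (z - c) in sz *.
have Dq : D z = r ^+ 2 - q by [].
have key : C * D z ^+ m.+2 < m.+2%:R * D z ^+ m.+1 * (-2 *+ n)
    + m.+2%:R * m.+1%:R * D z ^+ m * (-2 * (-2 * q)).
  have -> : C * D z ^+ m.+2 = D z ^+ m * (C * D z ^+ 2) by rewrite !exprS; ring.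
  have -> : m.+2%:R * D z ^+ m.+1 * (-2 *+ n) + m.+2%:R * m.+1%:R * D z ^+ m * (-2 * (-2 * q))
     = D z ^+ m * (m.+2%:R * (4 * m.+1%:R * q - 2 * n%:R * D z)) :> R.
    by rewrite -mulr_natr exprS; ring.
  rewrite ltr_pM2l ?exprn_gt0//.
  have D2 : D z ^+ 2 <= r ^+ 4.
    by rewrite [r ^+ 4](exprM r 2 2) lerXn2r// nnegrE ?ltW// exprn_gt0.
  have CD : C * D z ^+ 2 <= C * r ^+ 4 by rewrite ler_wpM2l.
  have nD : 2 * n%:R * D z <= 2 * n%:R * r ^+ 2 by rewrite ler_wpM2l// mulr_ge0.
  have mq : 4 * m.+1%:R * s ^+ 2 <= 4 * m.+1%:R * q by rewrite ler_wpM2l ?mulr_ge0// ltW.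
  have Cr : 0 <= C * r ^+ 4 by rewrite mulr_ge0// exprn_ge0// ltW.
  have pos : C * D z ^+ 2 < 4 * m.+1%:R * q - 2 * n%:R * D z.
    have E : 4 * m.+1%:R * s ^+ 2 = 4 * s ^+ 2 * m.+1%:R by ring.
    lra.
  apply: lt_le_trans pos _; rewrite ler_peMl// ?ler1n//.
  lra.
have epskey : eps * (C * D z ^+ m.+2) < eps * (m.+2%:R * D z ^+ m.+1 * (-2 *+ n)
    + m.+2%:R * m.+1%:R * D z ^+ m * (-2 * (-2 * q))) by rewrite ltr_pM2l.
have CG : C * G z <= 0 by rewrite mulr_ge0_le0// ltW.
move: CG epskey trM; rewrite /G.
lra.
Qed.

(** The set where [g > 0] is open and closed in [O]. For closedness, a limit point [z] is within
    [d / 2] of some [c] with [g c > 0], and the ball of radius [d / 2] about [c] contains [z] and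
    stays inside [O]. *)
Lemma strong_maximum O g (g1 : V -> V) M (C : R) :
  open O -> connected O -> jet2_on O g g1 M -> 0 <= C ->
  (forall x, O x -> {for x, continuous g}) ->
  (forall x, O x -> 0 <= g x) -> (forall x, O x -> \tr (M x) <= C * g x) ->
  (exists x, O x /\ g x != 0) -> forall x, O x -> 0 < g x.
Proof.
move=> oO conn J C0 cg g0 Mg [x0 [Ox0 gx0]].
pose B := [set x | O x /\ 0 < g x].
suff -> : O = B by move=> x [].
apply/esym/conn.
- by exists x0; split => //; rewrite lt_neqAle eq_sym gx0 g0.
- exists B; last by apply/seteqP; split => x; [case=> ? ?; split|case].
  rewrite openE => x [Ox gx].
  have n1 : nbhs x O by exact: open_nbhs_nbhs.
  have n2 : nbhs x [set y | 0 < g y].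
    apply: (cg x Ox [set s | 0 < s]).
    by apply: open_nbhs_nbhs; split => //; exact: open_gt.
  exact: filterS2 n1 n2.
- exists (closure B); first exact: closed_closure.
  apply/seteqP; split => [x Bx|z [Oz clz]].
    by split; [case: Bx | exact: subset_closure].
  have /nbhs_ballP[d' d'0 Hd] : nbhs z O by exact: open_nbhs_nbhs.
  pose d := d' / 2; have d0 : 0 < d by rewrite divr_gt0.
  have z0 : dot (z - z) (z - z) < (d / 2) ^+ 2.
    by rewrite subrr -[0 as X in dot X _](scale0r 0) dotZl mul0r exprn_gt0// divr_gt0.
  have /clz[c [[Oc gc] /= zc]] := continuous_at_lt (@continuous_sqdist z z) z0.
  have d20 : 0 < d / 2 by rewrite divr_gt0.
  split => //; apply: (ball_positivity oO J C0 cg g0 Mg d20 _ gc).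
    move=> x xc; apply: Hd; rewrite -ball_normE /ball_/=.
    rewrite -[z](subrK c) -addrA; apply: le_lt_trans (ler_normD _ _) _.
    have : `|z - c| <= d / 2.
      rewrite distrC; apply: le_trans (normr_le_enorm _) _.
      by rewrite enormE -[leRHS](ger0_norm (ltW d20)) -sqrtr_sqr ler_wsqrtr// ltW.
    have : `|c - x| <= d / 2.
      rewrite distrC; apply: le_trans (normr_le_enorm _) _.
      by rewrite enormE -[leRHS](ger0_norm (ltW d20)) -sqrtr_sqr; apply: ler_wsqrtr.
    rewrite /d; move: d'0 => /=; lra.
  by rewrite -opprB dotNl dotNr opprK.
Qed.

End StrongMaximum.

(** * Even primitives of the modulus *)

Section EvenPrimitive.
Variable R : realType.
Implicit Types (f w : R -> R) (s x h : R).

Lemma is_derive_bound f x (d e : R) : is_derive x 1 f d -> 0 < e ->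
  exists2 r : R, 0 < r & forall h, `|h| < r ->
     `|f (x + h) - f x - h * d| <= e * `|h|.
Proof.
move=> /is_derive_cvg/cvgrPdist_le /(_ e) cv e0.
have /nbhs_ballP[r r0 Hr] := cv e0; exists r => // h hr.
have [->|h0] := eqVneq h 0; first by rewrite addr0 mul0r subrr subr0 normr0 mulr0.
have := Hr h; rewrite -ball_normE /ball_/= sub0r normrN => /(_ hr h0) H.
have -> : f (x + h) - f x - h * d = - h * (d - h^-1 * (f (x + h) - f x)) by field.
by rewrite normrM normrN [leRHS]mulrC ler_wpM2l.
Qed.

Lemma continuous_clip w (L : R) : 0 <= L ->
  (forall s, 0 <= s <= L -> {for s, continuous w}) ->
  continuous (fun s => w (Num.max 0 (Num.min s L))).
Proof.
move=> L0 cw s; apply: (@continuous_at_comp _ _ s w).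
  apply: continuous_at_max; first exact: continuous_at_cst.
  exact: (@continuous_min _ _ id (fun=> L) s _ (@continuous_at_cst _ _ s L)).
apply: cw; rewrite le_max lexx/= ge_max L0/= ge_min lexx orbT//.
Qed.

(** The function [w] is extended by constants and integrated from [-1], so that [0] and [L] are
    interior points and the derivatives there are two-sided. *)
Lemma primitive_nonneg w (L : R) : 0 <= L ->
  (forall s, 0 <= s <= L -> {for s, continuous w}) ->
  exists J : R -> R, (forall s, 0 <= s -> {for s, continuous J}) /\
    (forall s, 0 <= s <= L -> is_derive s 1 J (w s)).
Proof.
move=> L0 cw.
pose wc s := w (Num.max 0 (Num.min s L)).
have cwc : continuous wc by exact: continuous_clip.
pose J x := (\int[lebesgue_measure]_(t in `[(-1)%R, x]) wc t)%R.
have dJ x : 0 <= x -> is_derive x 1 J (wc x).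
  move=> x0; have xx : x < x + 1 by lra.
  have int : lebesgue_measure.-integrable `[(-1)%R, x + 1] (EFin \o wc).
    apply: continuous_compact_integrable; first exact: segment_compact.
    exact: continuous_subspaceT.
  have x1 : -1 < x by lra.
  have [D1 D2] := continuous_FTC1_closed xx int x1 (cwc x).
  by split => //; rewrite -derive1E.
exists J; split => [s s0|s /andP[s0 sL]]; first exact: is_derive_cont (dJ s s0).
have -> : w s = wc s; last exact: dJ.
by rewrite /wc (min_l sL) (max_r s0).
Qed.

Lemma is_derive_even (J : R -> R) s (d : R) : s != 0 ->
  is_derive `|s| 1 J d -> is_derive s 1 (fun r => J `|r|) (Num.sg s * d).
Proof.
move=> s0 dJ; have [sn|sp|sE] := ltgtP s 0; last by rewrite sE eqxx in s0.
  rewrite (ltr0_norm sn) in dJ; rewrite (ltr0_sg sn).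
  have := @is_derive_affine R J 0 (-1) s d.
  rewrite mulrN1 sub0r => /(_ dJ); rewrite mulrN1 mulN1r.
  apply: near_eq_is_derive; near=> r.
  by rewrite add0r mulrN1 ltr0_norm//; near: r; exact: lt_nbhsl.
rewrite (gtr0_norm sp) in dJ; rewrite (gtr0_sg sp) mul1r.
apply: near_eq_is_derive dJ; near=> r.
by rewrite gtr0_norm//; near: r; exact: lt_nbhsr.
Unshelve. all: by end_near. Qed.

(** The coordinate [a = t b] takes both signs, so [w] is needed on both sides of [0]. *)
Definition odd_ext w s := Num.sg s * w `|s|.

(** The point at issue is [s = 0]: a maximum may occur at [t = 0], where [Xi] has to be
    differentiated twice. As [w 0 = 0], the odd extension has the slope [w1 0] on both sides. *)
Lemma even_primitive w (w1 : R -> R) (L : R) : 0 < L -> w 0 = 0 ->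
  (forall s, 0 <= s <= L -> is_derive s 1 w (w1 s)) ->
  exists Xi : R -> R, [/\ continuous Xi, forall s, Xi `|s| = Xi s,
    forall s, `|s| < L -> is_derive s 1 Xi (odd_ext w s) &
    forall s, `|s| < L -> is_derive s 1 (odd_ext w) (w1 `|s|)].
Proof.
move=> L0 w0 dw.
have [J [cJ dJ]] := primitive_nonneg (ltW L0) (fun s Hs => is_derive_cont (dw s Hs)).
have L00 : 0 <= (0 : R) <= L by rewrite lexx ltW.
exists (fun s => J `|s|); split.
- move=> s; apply: (@continuous_at_comp _ _ s J (fun r => `|r|)); first exact: norm_continuous.
  exact: cJ.
- by move=> s; rewrite normr_id.
- move=> s sL; have [->|s0] := eqVneq s 0; last first.
    by apply: is_derive_even => //; apply: dJ; rewrite normr_ge0 ltW.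
  (* Composing [J] with the modulus creates no corner at [0], since the slope of [J] there is
     [w 0 = 0]. *)
  rewrite /odd_ext sgr0 mul0r; apply: is_derive_eps => e e0.
  have [r r0 Hr] := is_derive_bound (dJ 0 L00) e0; exists r => // h hr.
  have := Hr `|h|; rewrite normr_id => /(_ hr).
  by rewrite w0 !mulr0 !add0r normr0.
- move=> s sL; have [->|s0] := eqVneq s 0; last first.
    have D : is_derive s 1 (fun r => w `|r|) (Num.sg s * w1 `|s|).
      by apply: is_derive_even => //; apply: dw; rewrite normr_ge0 ltW.
    have := is_deriveZ (Num.sg s) D; rewrite [X in is_derive _ _ _ X]mulrA.
    rewrite -expr2 sqr_sg s0 mul1r; apply: near_eq_is_derive.
    move: s0; rewrite neq_lt => /orP[] H; near=> r; rewrite /odd_ext /GRing.scale/=.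
      by rewrite !ltr0_sg//; near: r; exact: lt_nbhsl.
    by rewrite !gtr0_sg//; near: r; exact: lt_nbhsr.
  rewrite normr0; apply: is_derive_eps => e e0.
  have [r r0 Hr] := is_derive_bound (dw 0 L00) e0; exists r => // h hr.
  have := Hr `|h|; rewrite normr_id => /(_ hr).
  rewrite w0 !add0r subr0 /odd_ext sgr0 mul0r subr0.
  have [->|h0] := eqVneq h 0; first by rewrite sgr0 normr0 !mul0r subrr normr0 mulr0.
  have -> : Num.sg h * w `|h| - h * w1 0 = Num.sg h * (w `|h| - `|h| * w1 0).
    by rewrite mulrBr mulrA -numEsg.
  by rewrite normrM normr_sg h0 mul1r.
Unshelve. all: by end_near. Qed.

End EvenPrimitive.

(** * The boundary barrier *)

Section DomainTools.
Variables (R : realType) (n : nat).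
Local Notation V := 'rV[R]_n.
Local Notation "'e_ i" := (ebasis R i) (at level 8, i at level 2).
Implicit Types (g q u : V -> R) (x y v : V) (M : V -> 'M[R]_n) (O : set V).

Lemma Ck_on_continuous O g x : Ck_on 2 O g -> O x -> {for x, continuous g}.
Proof. by move=> Cg Ox; have [] := Cg [::] isT x Ox. Qed.

Lemma Ck_on_continuous_grad O g x i : Ck_on 2 O g -> O x ->
  {for x, continuous (fun y => grad g y 0 i)}.
Proof.
move=> Cg Ox; have [c _] := Cg [:: i] isT x Ox.
by rewrite (_ : (fun y => _) = 'D_('e_i) g)//; apply/funext => y; rewrite mxE.
Qed.

Lemma Ck_on_continuous_hess O g x i j : Ck_on 2 O g -> O x ->
  {for x, continuous (fun y => hessmx g y i j)}.
Proof.
move=> Cg Ox; have [c _] := Cg [:: j; i] isT x Ox.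
rewrite (_ : (fun y => _) = 'D_('e_j) ('D_('e_i) g))//.
by apply/funext => y; rewrite mxE.
Qed.

Lemma Ck_on_continuous_dotgrad O g x v : Ck_on 2 O g -> O x ->
  {for x, continuous (fun y => dot (grad g y) v)}.
Proof.
move=> Cg Ox; apply: continuous_sumr => i; apply: continuous_at_mul.
  exact: Ck_on_continuous_grad Cg Ox.
exact: continuous_at_cst.
Qed.

Lemma Ck_on_continuous_sqgrad O g x : Ck_on 2 O g -> O x ->
  {for x, continuous (fun y => dot (grad g y) (grad g y))}.
Proof.
move=> Cg Ox; apply: continuous_sumr => i.
by apply: continuous_at_mul; exact: Ck_on_continuous_grad Cg Ox.
Qed.

Lemma Ck_on_continuous_qform O g x v : Ck_on 2 O g -> O x ->
  {for x, continuous (fun y => dot (v *m hessmx g y) v)}.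
Proof.
move=> Cg Ox; apply: continuous_sumr => i.
apply: continuous_at_mul; last exact: continuous_at_cst.
rewrite (_ : (fun y => _) = (fun y => \sum_j v 0 j * hessmx g y j i)); last first.
  by apply/funext => y; rewrite mxE.
apply: continuous_sumr => j; apply: continuous_at_mul; first exact: continuous_at_cst.
exact: Ck_on_continuous_hess Cg Ox.
Qed.

Lemma Ck_on_continuous_trace O g x : Ck_on 2 O g -> O x ->
  {for x, continuous (fun y => \tr (hessmx g y))}.
Proof.
by move=> Cg Ox; apply: continuous_sumr => i; exact: Ck_on_continuous_hess Cg Ox.
Qed.

Lemma jet2_on_neg_ln O g : open O -> Ck_on 2 O g -> (forall x, O x -> 0 < g x) ->
  exists M, jet2_on O (fun x => - ln (g x)) (fun x => (- (g x)^-1) *: grad g x) M /\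
    forall x v, O x -> {for x, continuous (fun y => dot (v *m M y) v)}.
Proof.
move=> oO Cg gp.
have J := jet2_on_scale (-1) (jet2_on_ln gp (Ck_on_jet2 oO Cg)).
eexists; split.
  move: J; rewrite (_ : (fun x => -1 * ln (g x)) = (fun x => - ln (g x))).
    rewrite (_ : (fun x => -1 *: ((g x)^-1 *: grad g x)) =
       (fun x => (- (g x)^-1) *: grad g x)); last first.
      by apply/funext => x; rewrite scalerA mulN1r.
    exact.
  by apply/funext => x; rewrite mulN1r.
move=> x v Ox /=.
rewrite (_ : (fun y => _) = (fun y => (-1) * ((g y)^-1 * dot (v *m hessmx g y) v
   - (g y)^-1 * (g y)^-1 * (dot (grad g y) v * dot (grad g y) v)))); last first.
  apply/funext => y; rewrite -scalemxAr dotZl mulmxBr dotBl -!scalemxAr !dotZl.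
  by rewrite dot_outer expr2 invfM.
have cV : {for x, continuous (fun y => (g y)^-1)}.
  apply: continuous_at_inv; first by rewrite gt_eqF// gp.
  exact: Ck_on_continuous Cg Ox.
apply: continuous_at_mul; first exact: continuous_at_cst.
apply: continuous_at_sub; apply: continuous_at_mul => //.
- exact: Ck_on_continuous_qform Cg Ox.
- exact: continuous_at_mul.
- by apply: continuous_at_mul; exact: Ck_on_continuous_dotgrad Cg Ox.
Qed.

(** The eigenfunction is controlled on the closure of [O] only. Its extension by [0] is continuous
    everywhere, so it can be evaluated along configurations without subspace topologies. *)
Definition zero_ext O u x : R := if `[< O x >] then u x else 0.

Lemma zero_ext_in O u x : O x -> zero_ext O u x = u x.
Proof. by move=> Ox; rewrite /zero_ext asboolT. Qed.

Lemma zero_ext_out O u x : ~ O x -> zero_ext O u x = 0.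
Proof. by move=> Ox; rewrite /zero_ext asboolF. Qed.

Lemma continuous_zero_ext O u : open O ->
  (forall x, O x -> {for x, continuous u}) -> {within closure O, continuous u} ->
  (forall x, closure O x -> ~ O x -> u x = 0) -> continuous (zero_ext O u).
Proof.
move=> oO cu cuO u0 x.
have [Ox|nOx] := pselect (O x).
  rewrite /continuous_at (zero_ext_in u Ox).
  apply/(@cvgrPdist_lt _ _ _ (nbhs x)) => e e0; have /cvgrPdist_lt /(_ e e0) := cu x Ox.
  have : nbhs x O by exact: open_nbhs_nbhs.
  by apply: filterS2 => y Oy; rewrite zero_ext_in.
rewrite /continuous_at (zero_ext_out u nOx).
have [cx|ncx] := pselect (closure O x); last first.
  have no : nbhs x (~` closure O).
    by apply: open_nbhs_nbhs; split => //; exact: closed_openC (@closed_closure _ O).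
  apply/(@cvgrPdist_lt _ _ _ (nbhs x)) => e e0; move: no; apply: filterS => y ny.
  by rewrite zero_ext_out ?subrr ?normr0// => /subset_closure.
apply/(@cvgrPdist_lt _ _ _ (nbhs x)) => e e0.
have H : u @ within (closure O) (nbhs x) --> u x.
  exact: (subspace_continuousP (closure O) u).1 cuO x cx.
rewrite (u0 x cx nOx) in H.
have /cvgrPdist_lt /(_ e e0) := H; rewrite near_withinE.
apply: filterS => y Hy; have [Oy|nOy] := pselect (O y).
  by rewrite zero_ext_in//; apply: Hy; exact: subset_closure.
by rewrite zero_ext_out// subr0 normr0.
Unshelve. all: by end_near. Qed.

Lemma strictly_convex_inner O x y (t : R) : strictly_convex O ->
  O x -> O y -> `|t| <= 1 -> O (inner t x y).
Proof.
move=> scO Ox Oy; rewrite ler_norml => /andP[t1 t2].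
have [<-|xy] := eqVneq x y.
  by rewrite (_ : inner t x x = x)//; apply/rowP => i; rewrite !mxE; field.
have [->|tn1] := eqVneq t 1.
  by rewrite (_ : inner 1 x y = x)//; apply/rowP => i; rewrite !mxE; field.
have [->|tn2] := eqVneq t (- 1).
  by rewrite (_ : inner (-1) x y = y)//; apply/rowP => i; rewrite !mxE; field.
have s01 : 0 < (1 - t) / 2 < 1.
  have : t < 1 by rewrite lt_neqAle tn1.
  have : -1 < t by rewrite lt_neqAle eq_sym tn2.
  by move=> ? ?; apply/andP; split; lra.
have := scO x y (@subset_closure _ O x Ox) (@subset_closure _ O y Oy) xy _ s01.
by congr O; apply/rowP => i; rewrite !mxE; field.
Qed.

(* On the boundary [rho = 0], so only the term [- 4 k |grad rho|^2] of the
   Laplacian of [1 + (1 - k rho^2)^2] survives there. *)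
Lemma boundary_barrier O q (lam : R) : open O -> compact (closure O) ->
  smooth_boundary O -> (forall x, closure O x -> {for x, continuous q}) ->
  exists (h : V -> R) (h1 : V -> V) Mh,
    [/\ jet2_on setT h h1 Mh, continuous h, continuous (fun x => \tr (Mh x)),
      (forall x, 1 <= h x) &
      forall x, closure O x -> ~ O x -> \tr (Mh x) + (lam - q x) * h x < 0].
Proof.
move=> oO cO [rho [Srho [Orho Drho]]] cq.
have Cr : Ck_on 2 setT rho by exact: Srho.
have cr : continuous rho by move=> x; exact: Ck_on_continuous Cr _.
have cgr x : {for x, continuous (fun y => dot (grad rho y) (grad rho y))}.
  exact: Ck_on_continuous_sqgrad Cr _.
have ctr x : {for x, continuous (fun y => \tr (hessmx rho y))}.
  exact: Ck_on_continuous_trace Cr _.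
pose B := closure O `&` ~` O.
have cB : compact B.
  apply: (subclosed_compact _ cO); last by move=> x [].
  by apply: closedI; [exact: closed_closure | exact: open_closedC].
have rhoB x : B x -> rho x = 0.
  move=> [cx nOx]; apply/eqP; rewrite eq_le; apply/andP; split.
    by apply: closure_le (cr x) cx => y /Orho/ltW.
  by rewrite leNgt; apply/negP => /Orho.
have gpos x : B x -> 0 < dot (grad rho x) (grad rho x).
  move=> /rhoB/Drho[i di]; rewrite /dot (bigD1 i)//= ltr_pwDl//.
    by rewrite mxE -expr2 lt_neqAle sqr_ge0 andbT eq_sym sqrf_eq0.
  by apply: sumr_ge0 => j _; rewrite -expr2 sqr_ge0.
have [k0 Hk0] : exists k0, forall x, B x ->
    (lam - q x) * (dot (grad rho x) (grad rho x))^-1 <= k0.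
  apply: compact_ub cB _ => x Bx; apply: continuous_at_mul.
    apply: continuous_at_sub; first exact: continuous_at_cst.
    by apply: cq; case: Bx.
  by apply: continuous_at_inv (cgr x); rewrite gt_eqF// gpos.
(* On the boundary [h = 2], so the requirement there is [2 (lam - q) < 4 k |grad rho|^2], which
   holds once [k > k0 / 2]. The outer square in [h] ensures [h >= 1] also where [1 - k rho^2] is
   negative. *)
pose k := Num.max k0 0 + 1.
have J0 := Ck_on_jet2 openT Cr.
have J1 := jet2_on_exp 0 J0.
have J2 := jet2_on_add (@jet2_on_cst R n setT 1) (jet2_on_scale (- k) J1).
have J3 := jet2_on_add (@jet2_on_cst R n setT 1) (jet2_on_exp 0 J2).
pose G y := dot (grad rho y) (grad rho y); pose T y := \tr (hessmx rho y).
pose F y : R := 2 * (1 + - k * rho y ^+ 2) * (- k * (2 * rho y * T y + 2 * G y))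
  + 2 * (4 * k ^+ 2 * rho y ^+ 2 * G y).
have csq x (f : V -> R) : {for x, continuous f} -> {for x, continuous (fun y => f y ^+ 2)}.
  move=> cf; apply: (@continuous_at_comp _ _ _ (fun s => s ^+ 2) f cf).
  exact: exprn_continuous.
have cs x : {for x, continuous (fun y => 1 + - k * rho y ^+ 2)}.
  apply: continuous_at_add; first exact: continuous_at_cst.
  by apply: continuous_at_mul; [exact: continuous_at_cst | exact: csq (cr x)].
have ch x : {for x, continuous (fun y => 1 + (1 + - k * rho y ^+ 2) ^+ 2)}.
  by apply: continuous_at_add; [exact: continuous_at_cst | exact: csq (cs x)].
have cF x : {for x, continuous F}.
  have c0 (c : R) : {for x, continuous (fun _ : V => c)} by exact: continuous_at_cst.
  have crx : {for x, continuous rho} by exact: cr.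
  have cA := continuous_at_add (continuous_at_mul (continuous_at_mul (c0 2) crx) (ctr x))
    (continuous_at_mul (c0 2) (cgr x)).
  have cB' := continuous_at_mul (continuous_at_mul (c0 (4 * k ^+ 2)) (csq x rho crx)) (cgr x).
  exact: (continuous_at_add (continuous_at_mul (continuous_at_mul (c0 2) (cs x))
    (continuous_at_mul (c0 (- k)) cA)) (continuous_at_mul (c0 2) cB')).
move: J3; set h1 := (X in jet2_on _ _ X _); set Mh := (X in jet2_on _ _ _ X) => J3.
have trE : (fun x => \tr (Mh x)) = F.
  apply/funext => x; rewrite /Mh /F /T /G.
  rewrite !mxtraceD !mxtraceZ !mxtraceD !mxtraceZ !mxtraceD !mxtraceZ !mxtrace_outer.
  rewrite !mxtrace0 !add0r !dotZl !dotZr !expr1 !expr0; ring.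
exists (fun y => 1 + (1 + - k * rho y ^+ 2) ^+ 2), h1, Mh; split => //.
- by rewrite trE.
- by move=> x; rewrite lerDl sqr_ge0.
- move=> x cx nOx; have Bx : B x by [].
  have := congr1 (@^~ x) trE; rewrite /= => ->.
  rewrite /F (rhoB x Bx) expr0n /= !mulr0 !mul0r !mulr0 !addr0 add0r expr1n mulr1.
  have := Hk0 x Bx; rewrite ler_pdivrMr ?gpos// -/(G x) => H.
  have kk : k0 + 1 <= k by rewrite /k lerD2r le_max lexx.
  have k1 : 0 <= k by rewrite addr_ge0// le_max lexx orbT.
  have := mulr_ge0 k1 (ltW (gpos x Bx)).
  have := ler_wpM2r (ltW (gpos x Bx)) kk; have := gpos x Bx; rewrite -/(G x).
  lra.
Qed.

End DomainTools.

(** * The four-point inequality for [- ln u] *)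

Section Potential.
Variables (R : realType) (n : nat).
Local Notation V := 'rV[R]_n.
Implicit Types (x y z e : V) (O : set V).

Lemma rdist_symmetric z e (s : R) : dot e e = 1 -> 0 <= s ->
  rdist (z - s *: e) (z + s *: e) = 2 * s.
Proof.
move=> ee s0; rewrite /rdist.
have -> : z - s *: e - (z + s *: e) = (- (2 * s)) *: e.
  by apply/rowP => i; rewrite !mxE; ring.
by rewrite enormZ enormE ee sqrtr1 mulr1 normrN ger0_norm// mulr_ge0.
Qed.

Lemma Eg_symmetric O g (g1 : V -> V) M z e (s : R) : open O -> jet2_on O g g1 M ->
  (forall x v, O x -> {for x, continuous (fun y => dot (v *m M y) v)}) ->
  dot e e = 1 -> 0 < s -> (forall r, `|r| <= s -> O (z + r *: e)) ->
  Eg g (z - s *: e) (z + s *: e) = dot (g1 (z + s *: e)) e - dot (g1 (z - s *: e)) e.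
Proof.
move=> oO J cM ee s0 seg.
have rE := rdist_symmetric z ee (ltW s0).
have NE : Ndir (z - s *: e) (z + s *: e) = e.
  rewrite /Ndir rE; apply/rowP => i; rewrite !mxE; field; rewrite gt_eqF//.
have xy : z - s *: e != z + s *: e.
  apply/eqP => E; have := rE; rewrite E /rdist subrr.
  by rewrite -[0 as X in enorm X](scale0r 0) enormZ normr0 mul0r; lra.
rewrite (Eg_jet2 oO J cM xy) ?NE// => r; rewrite rE => /andP[r0 rs].
rewrite /theta NE (_ : _ + _ = z + (r - s) *: e).
  by apply: seg; rewrite ler_norml; apply/andP; split; lra.
by apply/rowP => i; rewrite !mxE; ring.
Qed.

(** The difference of the right side and [K], as a function of [s], has derivative
    [E_q - w w1 + w2 - k] for the pair [z - s e], [z + s e]. This is nonnegative by the bound on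
    [E_q] and the inequality for [w], and the mean value theorem concludes. *)
Lemma potential_gap O (q : V -> R) (q1 : V -> V) M (phi w w1 w2 K k : R -> R) (D : R)
    z e (a b : R) :
  open O -> jet2_on O q q1 M ->
  (forall x v, O x -> {for x, continuous (fun y => dot (v *m M y) v)}) ->
  (forall x y, O x -> O y -> rdist x y <= D) ->
  (forall x y, O x -> O y -> phi (rdist x y / 2) <= Eg q x y) ->
  (forall s : R, 0 <= s <= D / 2 -> [/\ is_derive s 1 w (w1 s), is_derive s 1 w1 (w2 s)
     & is_derive s 1 K (k s)]) ->
  (forall s, 0 < s <= D / 2 -> w s * w1 s - w2 s + k s <= phi s) ->
  dot e e = 1 -> 0 <= a <= b -> (forall r, `|r| <= b -> O (z + r *: e)) ->
  K b - K a <= (q (z + b *: e) + q (z - b *: e) - w b ^+ 2 / 2 + w1 b)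
             - (q (z + a *: e) + q (z - a *: e) - w a ^+ 2 / 2 + w1 a).
Proof.
move=> oO J cM diam Eq dw ineq ee /andP[a0 ab] seg.
have [<-|anb] := eqVneq a b; first by rewrite !subrr.
have ltab : a < b by rewrite lt_neqAle anb.
have segN r : `|r| <= b -> O (z + r *: (- e)).
  by move=> rb; rewrite scalerN -scaleNr; apply: seg; rewrite normrN.
have sD s : 0 <= s <= b -> s <= D / 2.
  move=> /andP[s0 sb]; have sn : `|s| <= b by rewrite ger0_norm.
  have := diam (z - s *: e) (z + s *: e).
  rewrite (rdist_symmetric z ee s0) => H.
  have : 2 * s <= D.
    by apply: H; [rewrite -scalerN; exact: segN | exact: seg].
  lra.
pose F s : R := q (z + s *: e) + q (z + s *: (- e)) + (- 2^-1) * w s ^+ 2 + w1 s - K s.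
pose F1 s : R := dot (q1 (z + s *: e)) e + dot (q1 (z + s *: (- e))) (- e)
   + (- 2^-1) * (2 * w s * w1 s) + w2 s - k s.
have dF s : 0 <= s <= b -> is_derive s 1 F (F1 s).
  move=> sb; have /andP[s0 sb'] := sb; have sn : `|s| <= b by rewrite ger0_norm.
  have [d1 d2 d3] : [/\ is_derive s 1 w (w1 s), is_derive s 1 w1 (w2 s)
     & is_derive s 1 K (k s)] by apply: dw; rewrite s0 sD.
  have q1' := (is_derive_line q z e s _).1 (J _ (seg s sn) e).1.
  have q2' := (is_derive_line q z (- e) s _).1 (J _ (segN s sn) (- e)).1.
  have dsq : is_derive s 1 (fun r => w r ^+ 2) (2 * w s * w1 s).
    have := is_deriveM d1 d1; rewrite (_ : w * w = fun r => w r ^+ 2).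
      by move=> H; apply: is_derive_eq H _; rewrite /GRing.scale/=; ring.
    by apply/funext => r; rewrite expr2.
  exact: (is_deriveB (is_deriveD (is_deriveD (is_deriveD q1' q2')
    (is_deriveZ (- 2^-1) dsq)) d2) d3).
have [||c] := @MVT R F F1 a b ltab.
- move=> s; rewrite in_itv/= => /andP[as_ sb]; apply: dF.
  by rewrite !ltW// (le_lt_trans a0).
- apply: derivable_within_continuous => s; rewrite in_itv/= => /andP[as_ sb].
  by apply: ex_derive; apply: dF; rewrite sb (le_trans a0).
rewrite in_itv/= => /andP[ac cb] E.
have c0 : 0 < c by exact: le_lt_trans a0 ac.
have cD : c <= D / 2 by apply: sD; rewrite !ltW.
have segc r : `|r| <= c -> O (z + r *: e) by move=> rc; apply: seg; rewrite (le_trans rc)// ltW.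
have cc : `|c| <= b by rewrite gtr0_norm// ltW.
have F10 : 0 <= F1 c.
  have := Eq (z - c *: e) (z + c *: e).
  rewrite (Eg_symmetric oO J cM ee c0 segc) (rdist_symmetric z ee (ltW c0)).
  rewrite mulrC mulKf// -scalerN => /(_ (segN c cc) (seg c cc)).
  have := ineq c; rewrite c0 cD => /(_ isT).
  rewrite /F1 dotNr; lra.
have ba : 0 <= b - a by rewrite subr_ge0.
have := mulr_ge0 F10 ba; rewrite -E.
rewrite /F !scalerN; lra.
Qed.

End Potential.

(** * Locating the maximum of the perturbed defect *)

Section FourPointInequality.
Variables (R : realType) (n : nat).
Local Notation V := 'rV[R]_n.
Implicit Types (x y : V) (t s : R) (z : V * V * R).

Definition inner_pt z : V := inner z.2 z.1.1 z.1.2.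
Definition inner_pt' z : V := inner (- z.2) z.1.1 z.1.2.
Definition half_dist z : R := rdist z.1.1 z.1.2 / 2.

Lemma continuous_fst1 z : {for z, continuous (fun z : V * V * R => z.1.1)}.
Proof.
case: z => [[x y] t].
by apply: (@continuous_comp _ _ _ fst fst); exact: cvg_fst.
Qed.

Lemma continuous_fst2 z : {for z, continuous (fun z : V * V * R => z.1.2)}.
Proof.
case: z => [[x y] t].
by apply: (@continuous_comp _ _ _ fst snd); [exact: cvg_fst | exact: cvg_snd].
Qed.

Lemma continuous_snd z : {for z, continuous (fun z : V * V * R => z.2)}.
Proof. by case: z => [[x y] t]; exact: cvg_snd. Qed.

Lemma continuous_inner (T : topologicalType) (f g : T -> V) (t : T -> R) (a : T) :
  {for a, continuous f} -> {for a, continuous g} -> {for a, continuous t} ->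
  {for a, continuous (fun c => inner (t c) (f c) (g c))}.
Proof.
move=> cf cg ct.
have ct1 : {for a, continuous (fun c => (1 + t c) / 2)}.
  apply: continuous_at_mul; last exact: continuous_at_cst.
  by apply: continuous_at_add => //; exact: continuous_at_cst.
have ct2 : {for a, continuous (fun c => (1 - t c) / 2)}.
  apply: continuous_at_mul; last exact: continuous_at_cst.
  by apply: continuous_at_sub => //; exact: continuous_at_cst.
exact: (@cvgD _ _ _ (nbhs a) _ (fun c => ((1 + t c) / 2) *: f c)
  (fun c => ((1 - t c) / 2) *: g c) _ _ (cvgZ ct1 cf) (cvgZ ct2 cg)).
Qed.

Lemma continuous_inner_pt z : {for z, continuous inner_pt}.
Proof.
exact: (continuous_inner (@continuous_fst1 z) (@continuous_fst2 z) (@continuous_snd z)).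
Qed.

Lemma continuous_inner_pt' z : {for z, continuous inner_pt'}.
Proof.
have cN : {for z, continuous (fun z : V * V * R => - z.2)}.
  by apply: (@cvgN _ _ _ (nbhs z)); exact: continuous_snd.
exact: (continuous_inner (@continuous_fst1 z) (@continuous_fst2 z) cN).
Qed.

Lemma continuous_half_dist z : {for z, continuous half_dist}.
Proof.
apply: continuous_at_mul; last exact: continuous_at_cst.
have cB : {for z, continuous (fun z : V * V * R => z.1.1 - z.1.2)}.
  apply: (@cvgB _ _ _ (nbhs z) _ (fun z : V * V * R => z.1.1)
   (fun z : V * V * R => z.1.2)); [exact: continuous_fst1|exact: continuous_fst2].
exact: (continuous_comp cB (@continuous_enorm R n _)).
Qed.

(** These are the degenerate configurations, in which the inner pair and the outer pair coincide. *)
Lemma inner_endpoints t x y : `|t| = 1 \/ x = y ->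
  (inner t x y = x /\ inner (- t) x y = y) \/ (inner t x y = y /\ inner (- t) x y = x).
Proof.
have i1 a b : inner 1 a b = a by apply/rowP => i; rewrite !mxE; field.
have i2 a b : inner (-1) a b = b by apply/rowP => i; rewrite !mxE; field.
case=> [|<-].
  move/eqP; rewrite eqr_norml ler01 andbT => /orP[] /eqP ->.
    by left; rewrite i1 i2.
  by right; rewrite opprK i1 i2.
by left; split; apply/rowP => i; rewrite !mxE; field.
Qed.

Variables (Om : set V) (q u : V -> R) (q1 : V -> V) (Mq : V -> 'M[R]_n) (lam D L : R).
Variables (phi w w1 w2 K k : R -> R).
Hypothesis oO : open Om.
Hypothesis cO : compact (closure Om).
Hypothesis scO : strictly_convex Om.
Hypothesis sbO : smooth_boundary Om.
Hypothesis cq : forall x, closure Om x -> {for x, continuous q}.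
Hypothesis Jq : jet2_on Om q q1 Mq.
Hypothesis cMq : forall x v, Om x -> {for x, continuous (fun y => dot (v *m Mq y) v)}.
Hypothesis Cu : Ck_on 2 Om u.
Hypothesis cuO : {within closure Om, continuous u}.
Hypothesis ub : forall x, closure Om x -> ~ Om x -> u x = 0.
Hypothesis up : forall x, Om x -> 0 < u x.
Hypothesis eqn : forall x, Om x -> \tr (hessmx u x) = (q x - lam) * u x.
Hypothesis diam : forall x y, Om x -> Om y -> rdist x y <= D.
Hypothesis Eq : forall x y, Om x -> Om y -> phi (rdist x y / 2) <= Eg q x y.
Hypotheses (L0 : 0 < L) (DL : D / 2 < L) (w0 : w 0 = 0).
Hypothesis dw : forall s : R, 0 <= s <= L ->
  [/\ is_derive s 1 w (w1 s), is_derive s 1 w1 (w2 s) & is_derive s 1 K (k s)].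
Hypothesis ineq : forall s, 0 < s <= D / 2 -> w s * w1 s - w2 s + k s <= phi s.
Hypothesis kpos : forall s, 0 < s <= D / 2 -> 0 < k s.

Let dw' s : 0 <= s <= D / 2 ->
  [/\ is_derive s 1 w (w1 s), is_derive s 1 w1 (w2 s) & is_derive s 1 K (k s)].
Proof. by move=> /andP[s0 sD]; apply: dw; rewrite s0 (le_trans sD)// ltW. Qed.

Lemma K_increasing (a b : R) : 0 <= a -> a < b -> b <= D / 2 -> K a < K b.
Proof.
move=> a0 ab bD.
have [||c] := @MVT R K k a b ab.
- move=> s; rewrite in_itv/= => /andP[as_ sb].
  by have [] := @dw' s; rewrite ?(le_trans a0 (ltW as_)) ?(le_trans (ltW sb)).
- apply: derivable_within_continuous => s; rewrite in_itv/= => /andP[as_ sb].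
  apply: ex_derive.
  by have [] := @dw' s; rewrite ?(le_trans a0 as_) ?(le_trans sb).
rewrite in_itv/= => /andP[ac cb] E; rewrite -subr_gt0 E mulr_gt0 ?subr_gt0//.
by apply: kpos; rewrite (le_lt_trans a0 ac) (le_trans (ltW cb)).
Qed.

Lemma closure_diameter x y : closure Om x -> closure Om y -> rdist x y <= D.
Proof.
have cd (a b : V) : {for b, continuous (fun c => rdist a c)}.
  have cB : {for b, continuous (fun c : V => a - c)}.
    apply: (@cvgB _ _ _ (nbhs b) _ (fun=> a) id); [exact: cvg_cst|exact: cvg_id].
  exact: (continuous_comp cB (@continuous_enorm R n _)).
have rC a b : rdist a b = rdist b a by rewrite /rdist -opprB enormN.
move=> cx cy; apply: (@closure_le _ _ Om (fun c => rdist x c)) => // b Ob.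
rewrite rC; apply: (@closure_le _ _ Om (fun c => rdist b c)) => // a Oa.
exact: diam.
Qed.

(** The sign of [t] only decides which inner point is which, so the gap for [|a|] applies. *)
Lemma potential_gap_inner x y t (a b : R) : Om x -> Om y -> x != y -> `|t| <= 1 ->
  b = rdist x y / 2 -> a = `|t * b| ->
  K b - K a <= q x + q y - q (inner t x y) - q (inner (- t) x y)
    - (w b ^+ 2 - w a ^+ 2) / 2 + (w1 b - w1 a).
Proof.
move=> Ox Oy xy t1 bE aE.
have b0 : 0 < b by rewrite bE divr_gt0// rdist_gt0.
have bn : b != 0 by rewrite gt_eqF.
pose z := inner 0 x y; pose e := (2 * b)^-1 *: (y - x).
have ee : dot e e = 1.
  rewrite /e dotZl dotZr -opprB dotNl dotNr opprK -enorm_sqr -/(rdist x y).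
  have -> : rdist x y = 2 * b by rewrite bE; field.
  by field.
have lineE r : z + r *: e = inner (- (r / b)) x y.
  by apply/rowP => i; rewrite !mxE; field.
have seg r : `|r| <= b -> Om (z + r *: e).
  move=> rb; rewrite lineE; apply: strictly_convex_inner => //.
  by rewrite normrN normrM normfV (gtr0_norm b0) ler_pdivrMr// mul1r.
have ab : 0 <= a <= b.
  by rewrite aE normr_ge0 normrM (gtr0_norm b0) ler_piMl// ltW.
have := potential_gap oO Jq cMq diam Eq dw' ineq ee ab seg.
have lineN r : z - r *: e = inner (r / b) x y.
  by rewrite -scaleNr lineE mulNr opprK.
rewrite !lineE !lineN divff//.
have [-> ->] : inner (-1) x y = y /\ inner 1 x y = x.
  by split; apply/rowP => i; rewrite !mxE; field.
have -> : q (inner (- (a / b)) x y) + q (inner (a / b) x y) =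
    q (inner t x y) + q (inner (- t) x y).
  rewrite aE normrM (gtr0_norm b0) mulfK//.
  by have [t0|t0] := leP 0 t; [rewrite (ger0_norm t0) addrC | rewrite (ltr0_norm t0) opprK].
lra.
Qed.

Let u0 : V -> R := zero_ext Om u.

Let u0E x : Om x -> u0 x = u x. Proof. exact: zero_ext_in. Qed.

Let u0_ge0 x : 0 <= u0 x.
Proof.
have [Ox|nOx] := pselect (Om x); first by rewrite u0E// ltW// up.
by rewrite /u0 zero_ext_out.
Qed.

Let cu0 x : {for x, continuous u0}.
Proof.
apply: continuous_zero_ext => // y Oy; exact: Ck_on_continuous Cu Oy.
Qed.

Section Perturbed.
Variables (h : V -> R) (h1 : V -> V) (Mh : V -> 'M[R]_n) (Xi : R -> R).
Hypothesis Jh : jet2_on setT h h1 Mh.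
Hypothesis h_ge1 : forall x, 1 <= h x.
Hypothesis dXi : forall s, `|s| < L -> is_derive s 1 Xi (odd_ext w s).
Hypothesis dwo : forall s, `|s| < L -> is_derive s 1 (odd_ext w) (w1 `|s|).

Let Lh x := \tr (Mh x) + (lam - q x) * h x.

(** The trace for [ln u] is [q - lam - |grad ln u|^2]; the one for [ln U] has the extra term
    [eps Lh / U]. Inserting both in the second order condition, then the gradient bound and the
    potential gap, leaves only [K] and this error. *)
Lemma perturbed_maximum (eps : R) x y t : 0 < eps ->
  let U := fun x => u0 x + eps * h x in
  Om x -> Om y -> x != y -> `|t| < 1 ->
  (forall x' y' t', Om x' -> Om y' -> `|t'| <= 1 ->
     four_point (fun x => ln (u0 x)) (fun x => ln (U x)) Xi x' y' t' <=
     four_point (fun x => ln (u0 x)) (fun x => ln (U x)) Xi x y t) ->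
  K (rdist x y / 2) - K `|t * (rdist x y / 2)| <=
    eps * (Lh (inner t x y) / U (inner t x y) + Lh (inner (- t) x y) / U (inner (- t) x y)).
Proof.
move=> eps0 U Ox Oy xy t1 maxi.
have t1' := ltW t1.
have Op : Om (inner t x y) by exact: strictly_convex_inner.
have Op' : Om (inner (- t) x y) by apply: strictly_convex_inner; rewrite ?normrN.
have Ju : jet2_on Om u0 (grad u) (hessmx u).
  by apply: jet2_on_eq oO _ (Ck_on_jet2 oO Cu) => z /u0E.
have JU := jet2_on_add Ju (jet2_on_scale eps (jet2_on_sub (@subsetT _ Om) Jh)).
have u0p (z : V) : Om z -> 0 < u0 z by move=> Oz; rewrite u0E// up.
have Up (z : V) : Om z -> 0 < U z.
  move=> Oz; rewrite /U addr_gt0 ?u0p// mulr_gt0// (lt_le_trans ltr01)//.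
have JA := jet2_on_ln u0p Ju.
have JB := jet2_on_ln Up JU.
have b0 : 0 < rdist x y / 2 by rewrite divr_gt0// rdist_gt0.
have bL : rdist x y / 2 < L.
  apply: le_lt_trans DL; by rewrite ler_pM2r ?invr_gt0// diam.
have lap := four_point_laplacian oO JA JB dXi dwo Ox Oy Op Op' xy t1 bL maxi.
have gra := four_point_gradients oO JA JB dXi Ox Oy Op Op' xy t1 bL maxi.
have gap := potential_gap_inner Ox Oy xy t1' erefl erefl.
move: lap gra gap; set b := rdist x y / 2; set a := `|t * b|.
have -> : odd_ext w b = w b by rewrite /odd_ext gtr0_sg// mul1r gtr0_norm.
have -> : odd_ext w (t * b) ^+ 2 = w a ^+ 2.
  rewrite /odd_ext -/a exprMn sqr_sg /a; have [->|_] := eqVneq (t * b) 0.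
    by rewrite normr0 w0 expr0n mulr0.
  by rewrite mul1r.
rewrite (gtr0_norm b0).
have trA (z : V) : Om z -> \tr ((u0 z)^-1 *: hessmx u z - (u0 z) ^- 2 *: ((grad u z)^T *m grad u z))
    = q z - lam - dot ((u0 z)^-1 *: grad u z) ((u0 z)^-1 *: grad u z).
  move=> Oz; rewrite linearB/= !mxtraceZ mxtrace_outer eqn// dotZl dotZr -u0E//.
  by field; rewrite gt_eqF// u0p.
have trB (z : V) : Om z -> \tr ((U z)^-1 *: (hessmx u z + eps *: Mh z)
      - (U z) ^- 2 *: ((grad u z + eps *: h1 z)^T *m (grad u z + eps *: h1 z)))
    = q z - lam + eps * (Lh z / U z)
      - dot ((U z)^-1 *: (grad u z + eps *: h1 z)) ((U z)^-1 *: (grad u z + eps *: h1 z)).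
  move=> Oz; have Uz : U z != 0 by rewrite gt_eqF// Up.
  rewrite linearB/= !mxtraceZ mxtraceD mxtraceZ mxtrace_outer eqn//.
  rewrite [dot (_^-1 *: _) _]dotZl [dot _ (_^-1 *: _)]dotZr -u0E//.
  move: (dot _ _) => G; have uU : u0 z = U z - eps * h z by rewrite /U addrK.
  by rewrite uU /Lh; field.
rewrite !trA// !trB// => lap gra gap; apply: le_trans gap _.
lra.
Qed.

End Perturbed.

(** The exponential of the defect, in a form that also makes sense where [u0] vanishes. It is [0] if
    an outer point is on the boundary and continuous on the closed configuration space, so its
    maximum exists. *)
Let ratio (Xi : R -> R) (U : V -> R) z : R :=
  u0 z.1.1 * u0 z.1.2 * expR (Xi (half_dist z) - Xi (z.2 * half_dist z))
  * (U (inner_pt z) * U (inner_pt' z))^-1.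

Let ratioE (Xi : R -> R) (U : V -> R) z : (forall x, 0 < U x) -> 0 < u0 z.1.1 -> 0 < u0 z.1.2 ->
  ratio Xi U z =
  expR (four_point (fun x => ln (u0 x)) (fun x => ln (U x)) Xi z.1.1 z.1.2 z.2).
Proof.
move=> Up ux uy; rewrite /four_point !expRD !expRN -/(inner_pt z) -/(inner_pt' z)
  -/(half_dist z) !lnK ?posrE// /ratio expRD expRN invfM; ring.
Qed.

Let continuous_ratio (Xi : R -> R) (U : V -> R) z :
  continuous Xi -> continuous U -> (forall x, 0 < U x) ->
  {for z, continuous (ratio Xi U)}.
Proof.
move=> cXi cU Up.
have cu1 : {for z, continuous (fun z => u0 z.1.1)}.
  exact: (continuous_comp (@continuous_fst1 z) (@cu0 _)).
have cu2 : {for z, continuous (fun z => u0 z.1.2)}.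
  exact: (continuous_comp (@continuous_fst2 z) (@cu0 _)).
have cb := @continuous_half_dist z.
have ca := continuous_at_mul (@continuous_snd z) cb.
have cX : {for z, continuous (fun z => Xi (half_dist z) - Xi (z.2 * half_dist z))}.
  exact: (continuous_at_sub (@continuous_at_comp _ _ _ Xi _ cb (cXi _))
    (@continuous_at_comp _ _ _ Xi _ ca (cXi _))).
have cE : {for z, continuous (fun z => expR (Xi (half_dist z) - Xi (z.2 * half_dist z)))}.
  exact: (@continuous_at_comp _ _ _ expR _ cX (@continuous_expR R _)).
have cp : {for z, continuous (fun z => U (inner_pt z))}.
  exact: (continuous_comp (@continuous_inner_pt z) (@cU _)).
have cp' : {for z, continuous (fun z => U (inner_pt' z))}.
  exact: (continuous_comp (@continuous_inner_pt' z) (@cU _)).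
have U0 : U (inner_pt z) * U (inner_pt' z) != 0 by rewrite gt_eqF// mulr_gt0.
exact: (continuous_at_mul (continuous_at_mul (continuous_at_mul cu1 cu2) cE)
  (@continuous_at_inv _ _ _ (fun z => U (inner_pt z) * U (inner_pt' z)) U0
     (continuous_at_mul cp cp'))).
Qed.

Let dom : set (V * V * R) := (closure Om `*` closure Om) `*` `[(-1), 1].

Let compact_dom : compact dom.
Proof. by apply: compact_setX; [exact: compact_setX | exact: segment_compact]. Qed.

(* [K b = K |a|] only if [|t| = 1] or [x = y], and then the two pairs coincide. *)
Let separation (Xi : R -> R) (eta mu : R) : continuous Xi -> (forall s, Xi `|s| = Xi s) ->
  0 < eta -> 0 < mu ->
  exists2 c, 0 < c & forall z, dom z ->
    mu <= u0 (inner_pt z) -> mu <= u0 (inner_pt' z) ->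
    expR eta * (u0 (inner_pt z) * u0 (inner_pt' z)) * expR (Xi (z.2 * half_dist z))
      <= u0 z.1.1 * u0 z.1.2 * expR (Xi (half_dist z)) ->
    c <= K (half_dist z) - K `|z.2 * half_dist z|.
Proof.
move=> cXi eXi eta0 mu0.
pose kap z := K (half_dist z) - K `|z.2 * half_dist z|.
pose gap z := expR eta * (u0 (inner_pt z) * u0 (inner_pt' z)) * expR (Xi (z.2 * half_dist z))
      - u0 z.1.1 * u0 z.1.2 * expR (Xi (half_dist z)).
(* Positivity of this maximum says that the three side conditions force [kap z > 0]; compactness
   turns it into a uniform bound. The ratio condition is multiplied out because [u0] may vanish. *)
pose g z := Num.max (Num.max (kap z) (gap z))
   (Num.max (mu - u0 (inner_pt z)) (mu - u0 (inner_pt' z))).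
have bounds z : dom z -> [/\ closure Om z.1.1, closure Om z.1.2, `|z.2| <= 1,
    0 <= half_dist z <= D / 2 & 0 <= `|z.2 * half_dist z| <= half_dist z].
  case: z => [[x y] t] [[/= cx cy]]; rewrite in_itv/= => t1.
  have t1' : `|t| <= 1 by rewrite ler_norml.
  have b0 : 0 <= half_dist (x, y, t) by rewrite divr_ge0// enorm_ge0.
  split => //; rewrite ?b0 ?normr_ge0//=.
    by rewrite /half_dist/= ler_pM2r ?invr_gt0// closure_diameter.
  by rewrite normrM (ger0_norm b0) ler_piMl.
have cont z : dom z -> {for z, continuous g}.
  move=> dz; have [_ _ _ bD aD] := bounds z dz.
  have cb := @continuous_half_dist z.
  have ca := continuous_at_mul (@continuous_snd z) cb.
  have cna : {for z, continuous (fun z => `|z.2 * half_dist z|)} by exact: cvg_norm ca.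
  have cK s : 0 <= s <= D / 2 -> {for s, continuous K}.
    by move=> /dw'[_ _]; exact: is_derive_cont.
  have cu1 : {for z, continuous (fun z => u0 z.1.1)}.
    exact: (continuous_comp (@continuous_fst1 z) (@cu0 _)).
  have cu2 : {for z, continuous (fun z => u0 z.1.2)}.
    exact: (continuous_comp (@continuous_fst2 z) (@cu0 _)).
  have cp : {for z, continuous (fun z => u0 (inner_pt z))}.
    exact: (continuous_comp (@continuous_inner_pt z) (@cu0 _)).
  have cp' : {for z, continuous (fun z => u0 (inner_pt' z))}.
    exact: (continuous_comp (@continuous_inner_pt' z) (@cu0 _)).
  have ckap : {for z, continuous kap}.
    have aD' : 0 <= `|z.2 * half_dist z| <= D / 2.
      by case/andP: aD => -> /le_trans; apply; case/andP: bD.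
    exact: (continuous_at_sub (@continuous_at_comp _ _ _ K _ cb (cK _ bD))
      (@continuous_at_comp _ _ _ K _ cna (cK _ aD'))).
  have cEb : {for z, continuous (fun z => expR (Xi (half_dist z)))}.
    exact: (@continuous_at_comp _ _ _ expR _
      (@continuous_at_comp _ _ _ Xi _ cb (cXi _)) (@continuous_expR R _)).
  have cEa : {for z, continuous (fun z => expR (Xi (z.2 * half_dist z)))}.
    exact: (@continuous_at_comp _ _ _ expR _
      (@continuous_at_comp _ _ _ Xi _ ca (cXi _)) (@continuous_expR R _)).
  have cgap : {for z, continuous gap}.
    exact: (continuous_at_sub (continuous_at_mul (continuous_at_mul
      (@continuous_at_cst _ _ z (expR eta)) (continuous_at_mul cp cp')) cEa)
      (continuous_at_mul (continuous_at_mul cu1 cu2) cEb)).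
  have cmu := @continuous_at_cst _ _ z mu.
  exact: (continuous_at_max (continuous_at_max ckap cgap)
    (continuous_at_max (continuous_at_sub cmu cp) (continuous_at_sub cmu cp'))).
have pos z : dom z -> 0 < g z.
  move=> dz; have [_ _ t1 /andP[b0 bD] /andP[a0 ab]] := bounds z dz.
  rewrite !lt_max.
  have [|kz] := ltP 0 (kap z); first by [].
  have [|pz] := ltP 0 (mu - u0 (inner_pt z)); first by rewrite orbT.
  have [|pz'] := ltP 0 (mu - u0 (inner_pt' z)); first by rewrite !orbT.
  rewrite subr_le0 in pz; rewrite subr_le0 in pz'; rewrite subr_le0 in kz.
  have {}ab : `|z.2 * half_dist z| = half_dist z.
    apply/eqP; rewrite eq_le ab leNgt; apply/negP => lt_ab.
    by have := K_increasing a0 lt_ab bD; rewrite ltNge kz.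
  rewrite orbF /= /gap -eXi ab.
  have Pz : u0 (inner_pt z) * u0 (inner_pt' z) = u0 z.1.1 * u0 z.1.2.
    have : `|z.2| = 1 \/ z.1.1 = z.1.2.
      have [->|xy] := eqVneq z.1.1 z.1.2; [by right | left].
      have bp : 0 < half_dist z by rewrite divr_gt0// rdist_gt0.
      move: ab; rewrite normrM (ger0_norm b0) -[RHS]mul1r.
      by move/(mulIf (lt0r_neq0 bp)).
    rewrite /inner_pt /inner_pt' => /inner_endpoints[[-> ->]//|[-> ->]].
    by rewrite mulrC.
  have Z0 : 0 < u0 z.1.1 * u0 z.1.2 * expR (Xi (half_dist z)).
    by rewrite -Pz !mulr_gt0 ?expR_gt0//; apply: lt_le_trans mu0 _.
  rewrite Pz -mulrA subr_gt0 ltr_pMl//.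
  by rewrite orbF expR_gt1.
have [c c0 Hc] := compact_pos_lb compact_dom cont pos.
exists c => // z dz pz pz' gz; have := Hc z dz; rewrite /g !le_max.
have F1 : (c <= gap z) = false.
  by apply/negbTE; rewrite -ltNge /gap; apply: le_lt_trans c0; rewrite subr_le0.
have F2 : (c <= mu - u0 (inner_pt z)) = false.
  by apply/negbTE; rewrite -ltNge; apply: le_lt_trans c0; rewrite subr_le0.
have F3 : (c <= mu - u0 (inner_pt' z)) = false.
  by apply/negbTE; rewrite -ltNge; apply: le_lt_trans c0; rewrite subr_le0.
by rewrite F1 F2 F3 !orbF.
Qed.

Lemma four_point_log_le0 : exists Xi : R -> R,
  (forall s, `|s| < L -> is_derive s 1 Xi (odd_ext w s)) /\
  forall x y t, Om x -> Om y -> `|t| <= 1 ->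
    four_point (fun x => ln (u x)) (fun x => ln (u x)) Xi x y t <= 0.
Proof.
have dw1 s : 0 <= s <= L -> is_derive s 1 w (w1 s) by move=> /dw[].
have [Xi [cXi eXi dXi dwo]] := even_primitive L0 w0 dw1.
have [h [h1 [Mh [Jh ch ctrh h_ge1 Lhb]]]] := boundary_barrier lam oO cO sbO cq.
pose Lh x := \tr (Mh x) + (lam - q x) * h x.
have cLh x : closure Om x -> {for x, continuous Lh}.
  move=> cx; have ctx : {for x, continuous (fun x => \tr (Mh x))} by exact: ctrh.
  have chx : {for x, continuous h} by exact: ch.
  exact: (continuous_at_add ctx (continuous_at_mul
    (continuous_at_sub (@continuous_at_cst _ _ x lam) (cq cx)) chx)).
(* Inside the domain [u0 > 0] and on the boundary [Lh < 0], so every point has [u0 >= c] or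
   [Lh <= - c]. *)
have [c c0 Hc] : exists2 c, 0 < c & forall x, closure Om x -> c <= Num.max (u0 x) (- Lh x).
  apply: compact_pos_lb cO _ _ => x cx.
    apply: continuous_at_max; first exact: cu0.
    by apply: (@cvgN _ _ _ (nbhs x)); exact: cLh.
  rewrite lt_max; have [Ox|nOx] := pselect (Om x); first by rewrite u0E// up.
  by rewrite oppr_gt0 Lhb// orbT.
have [C1' HC1'] := compact_ub cO cLh.
have [hm' Hhm'] : exists hm, forall x, closure Om x -> h x <= hm.
  by apply: compact_ub cO _ => x _; exact: ch.
pose hm := Num.max hm' 1.
have hm0 : 0 < hm by rewrite lt_max ltr01 orbT.
have Hhm x : Om x -> h x <= hm.
  by move=> Ox; rewrite le_max Hhm'//; exact: subset_closure.
pose C1 := Num.max C1' 0.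
have C10 : 0 <= C1 by rewrite le_max lexx orbT.
have HC1 x : Om x -> Lh x <= C1.
  by move=> Ox; rewrite le_max HC1'//; exact: subset_closure.
(* This bounds the error [Lh / U] from above: where [Lh > 0], the choice of [c] gives
   [U >= u0 >= c]. *)
pose C2 := C1 / c.
have C20 : 0 <= C2 by rewrite divr_ge0// ltW.
have C21 : 0 < 2 * (C2 + 1) by rewrite mulr_gt0// ltr_wpDl.
(* If [u0 < mu] at an inner point, then [U <= 2 mu] for small [eps] and [Lh <= - c]. The error there
   is at most [- c / (2 mu) = - (C2 + 1)], which outweighs the at most [C2] from the other inner
   point. *)
pose mu := c / (2 * (C2 + 1)).
have mu0 : 0 < mu by rewrite divr_gt0.
have muc : mu <= c.
  by rewrite ler_pdivrMr// ler_peMr ?(ltW c0)//; lra.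
exists Xi; split => // xs ys ts Oxs Oys ts1; rewrite leNgt; apply/negP => Vpos.
set Vs := four_point _ _ _ _ _ _ in Vpos.
(* Half of the assumed positive defect survives the perturbation when [eps] is small. *)
pose eta := Vs / 2.
have eta0 : 0 < eta by rewrite divr_gt0.
have [c' c'0 Hc'] := separation cXi eXi eta0 mu0.
pose U (eps : R) x := u0 x + eps * h x.
have Up eps x : 0 < eps -> 0 < U eps x.
  by move=> e0; rewrite ltr_wpDl// mulr_gt0// (lt_le_trans ltr01).
have cU eps : continuous (U eps).
  move=> x; apply: (continuous_at_add (@cu0 x)).
  by apply: continuous_at_mul (@continuous_at_cst _ _ x eps) _; exact: ch.
have Ops : Om (inner ts xs ys) by exact: strictly_convex_inner.
have Ops' : Om (inner (- ts) xs ys) by apply: strictly_convex_inner; rewrite ?normrN.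
pose zs := (xs, ys, ts).
have near_ratio : \forall eps \near (0 : R), expR eta *
    (U eps (inner_pt zs) * U eps (inner_pt' zs)) <
    u xs * u ys * expR (Xi (half_dist zs) - Xi (ts * half_dist zs)).
  apply: (@continuous_at_lt _ _ _ (fun eps => expR eta *
    (U eps (inner_pt zs) * U eps (inner_pt' zs)))).
    have cl (z : V) : {for (0 : R), continuous (fun eps => U eps z)}.
      apply: (continuous_at_add (@continuous_at_cst _ _ (0 : R) (u0 z))).
      apply: continuous_at_mul; [exact: cvg_id | exact: continuous_at_cst].
    exact: (continuous_at_mul (@continuous_at_cst _ _ (0 : R) (expR eta))
      (continuous_at_mul (cl _) (cl _))).
  rewrite /U !mul0r !addr0 !u0E//.
  have -> : u xs * u ys * expR (Xi (half_dist zs) - Xi (ts * half_dist zs)) =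
     expR Vs * (u (inner_pt zs) * u (inner_pt' zs)).
    rewrite /Vs /four_point !expRD !expRN !lnK ?posrE ?up//.
    rewrite /inner_pt /inner_pt' /half_dist /=; field.
    by rewrite !gt_eqF ?up ?expR_gt0.
  by rewrite ltr_pM2r ?mulr_gt0 ?up// ltr_expR /eta; lra.
have [r r0 Hr] := (nbhs_ballP _ _).1 near_ratio.
(* The three bounds keep the ratio at [zs] above [expR eta], ensure [eps h <= mu], and make the
   total error [2 eps C2] smaller than the separation constant [c']. *)
pose eps := Num.min (r / 2) (Num.min (mu / hm) (c' / (2 * (2 * (C2 + 1))))).
have eps0 : 0 < eps by rewrite !lt_min !divr_gt0// mulr_gt0.
have epsr : eps < r.
  have : eps <= r / 2 by rewrite ge_min lexx.
  by move: r0 => /=; lra.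
have epshm : eps * hm <= mu.
  by rewrite -(ler_pdivlMr _ _ hm0) /eps !ge_min lexx orbT.
have epsC2 : eps * (2 * (2 * (C2 + 1))) <= c'.
  have C40 : 0 < 2 * (2 * (C2 + 1)) by rewrite mulr_gt0.
  by rewrite -(ler_pdivlMr _ _ C40) /eps !ge_min lexx !orbT.
have {}Up x : 0 < U eps x by exact: Up.
have rs : expR eta < ratio Xi (U eps) zs.
  have := Hr eps; rewrite -ball_normE /ball_/= sub0r normrN gtr0_norm// => /(_ epsr).
  by rewrite -ltr_pdivlMr ?mulr_gt0// /ratio /= !u0E.
have doms : dom zs.
  by split; [split; exact: subset_closure | rewrite /= in_itv/= -ler_norml].
have cr : {within dom, continuous (ratio Xi (U eps))}.
  by apply: continuous_in_subspaceT => z _; apply: continuous_ratio => //; exact: cU.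
have dom0 : dom !=set0 by exists zs.
have [[[x y] t] /set_mem dz maxz] := compact_EVT_max dom0 compact_dom cr.
have rz : expR eta < ratio Xi (U eps) (x, y, t).
  exact: lt_le_trans rs (maxz zs (mem_set doms)).
have t1 : `|t| <= 1 by case: dz => _; rewrite /= in_itv/= -ler_norml.
(* The maximal ratio is positive, so neither outer point lies on the boundary. *)
have [ux uy] : 0 < u0 x /\ 0 < u0 y.
  have Z : 0 < u0 x * u0 y.
    have := lt_trans (expR_gt0 eta) rz; rewrite /ratio/=.
    have i0 : 0 < (U eps (inner_pt (x, y, t)) * U eps (inner_pt' (x, y, t)))^-1.
      by rewrite invr_gt0 mulr_gt0.
    by rewrite (pmulr_lgt0 _ i0) (pmulr_lgt0 _ (expR_gt0 _)).
  rewrite !lt_neqAle !u0_ge0 !andbT; split; apply/eqP => E.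
    by move: Z; rewrite -E mul0r ltxx.
  by move: Z; rewrite -E mulr0 ltxx.
have Ox : Om x.
  by apply: contrapT => nOx; move: ux; rewrite /u0 zero_ext_out// ltxx.
have Oy : Om y.
  by apply: contrapT => nOy; move: uy; rewrite /u0 zero_ext_out// ltxx.
have Op : Om (inner t x y) by exact: strictly_convex_inner.
have Op' : Om (inner (- t) x y) by apply: strictly_convex_inner; rewrite ?normrN.
have u0U (z : V) : u0 z <= U eps z.
  by rewrite lerDl mulr_ge0 ?(ltW eps0)// (le_trans ler01).
(* In a degenerate configuration the [Xi] terms cancel and the ratio is
   [u0 x u0 y / (U x U y) <= 1], below [expR eta]. *)
have nondeg : ~ (`|t| = 1 \/ x = y).
  move=> H; have XE : Xi (half_dist (x, y, t)) - Xi (t * half_dist (x, y, t)) = 0.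
    apply/eqP; rewrite subr_eq0; apply/eqP.
    case: H => [tE|->].
      by rewrite -[RHS]eXi normrM tE mul1r eXi.
    by rewrite /half_dist /rdist /= subrr -[0 as X in enorm X](scale0r 0) enormZ
      normr0 mul0r mul0r mulr0.
  move: rz; rewrite /ratio XE expR0 mulr1 /inner_pt /inner_pt' /=.
  have -> : U eps (inner t x y) * U eps (inner (- t) x y) = U eps x * U eps y.
    by have [[-> ->]//|[-> ->]] := inner_endpoints H; rewrite mulrC.
  apply/negP; rewrite -leNgt; apply: (@le_trans _ _ 1).
    by rewrite ler_pdivrMr ?mulr_gt0// mul1r ler_pM.
  by rewrite ltW// expR_gt1.
have xy : x != y by apply/eqP => E; apply: nondeg; right.
have t1' : `|t| < 1.
  by rewrite lt_neqAle t1 andbT; apply/eqP => E; apply: nondeg; left.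
have maxi x' y' t' : Om x' -> Om y' -> `|t'| <= 1 ->
     four_point (fun x => ln (u0 x)) (fun x => ln (U eps x)) Xi x' y' t' <=
     four_point (fun x => ln (u0 x)) (fun x => ln (U eps x)) Xi x y t.
  move=> Ox' Oy' t1''; rewrite -ler_expR.
  have dz' : dom (x', y', t').
    by split; [split; exact: subset_closure | rewrite /= in_itv/= -ler_norml].
  have := maxz (x', y', t') (mem_set dz').
  by rewrite !ratioE//= u0E// up.
have gap := perturbed_maximum Jh h_ge1 dXi dwo eps0 Ox Oy xy t1' maxi.
move: gap; rewrite -/(U eps _) -/(U eps _) -/(Lh _) -/(Lh _).
set p := inner t x y; set p' := inner (- t) x y; set b := rdist x y / 2.
have b0 : 0 <= b by rewrite divr_ge0// enorm_ge0.
have ab : `|t * b| < b.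
  by rewrite normrM (ger0_norm b0) gtr_pMl// divr_gt0// rdist_gt0.
have bD : b <= D / 2 by rewrite ler_pM2r ?invr_gt0// diam.
have Kab : K `|t * b| < K b by exact: K_increasing.
have errC (z : V) : Om z -> Lh z / U eps z <= C2.
  move=> Oz; have [Lz|Lz] := leP (Lh z) 0.
    by apply: le_trans C20; rewrite mulr_le0_ge0// invr_ge0 ltW.
  have uz : c <= u0 z.
    have := Hc z (@subset_closure _ Om z Oz); rewrite le_max => /orP[//|H].
    by have := lt_le_trans c0 H; rewrite oppr_gt0 ltNge (ltW Lz).
  rewrite /C2; apply: ler_pM; rewrite ?invr_ge0 ?(ltW Lz) ?(ltW (Up z))//.
    exact: HC1.
  by rewrite lef_pV2 ?posrE// (le_trans uz).
have err_small (z : V) : Om z -> u0 z < mu -> Lh z / U eps z <= - (C2 + 1).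
  move=> Oz uz.
  have Lz : Lh z <= - c.
    have := Hc z (@subset_closure _ Om z Oz); rewrite le_max => /orP[H|].
      by have := lt_le_trans uz (le_trans muc H); rewrite ltxx.
    by rewrite lerNr.
  have Uz : U eps z <= 2 * mu.
    have : eps * h z <= eps * hm by rewrite ler_wpM2l ?(ltW eps0)// Hhm.
    by rewrite /U; lra.
  rewrite ler_pdivrMr// mulNr; apply: le_trans Lz _; rewrite lerN2.
  apply: (@le_trans _ _ ((C2 + 1) * (2 * mu))).
    by rewrite ler_wpM2l// addr_ge0.
  by rewrite /mu le_eqVlt; apply/orP; left; apply/eqP; field; rewrite gt_eqF// ltr_wpDl.
move=> gap.
(* As [K b > K |a|], the total error is positive. This forces [u0 >= mu] at both inner points, and
   then [separation] makes the left side too large for an error of order [eps]. *)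
have err0 : 0 < Lh p / U eps p + Lh p' / U eps p'.
  by rewrite -(pmulr_rgt0 _ eps0); apply: lt_le_trans gap; rewrite subr_gt0.
have pmu : mu <= u0 p.
  rewrite leNgt; apply/negP => /(err_small p Op) H.
  by have := errC p' Op'; lra.
have pmu' : mu <= u0 p'.
  rewrite leNgt; apply/negP => /(err_small p' Op') H.
  by have := errC p Op; lra.
have := Hc' (x, y, t) dz pmu pmu'.
rewrite /half_dist /inner_pt /inner_pt' /= -/b -/p -/p' => Hk.
have : c' <= K b - K `|t * b|.
  apply: Hk.
  have : expR eta * (U eps p * U eps p') <= u0 x * u0 y * expR (Xi b - Xi (t * b)).
    by rewrite -ler_pdivlMr ?mulr_gt0//; exact: ltW rz.
  rewrite expRD expRN => H.
  have H' : expR eta * (u0 p * u0 p') <= expR eta * (U eps p * U eps p').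
    by rewrite ler_wpM2l ?expR_ge0// ler_pM.
  have := le_trans H' H; rewrite [X in _ <= X]mulrA ler_pdivlMr ?expR_gt0//.
have := ler_wpM2l (ltW eps0) (lerD (errC p Op) (errC p' Op')).
have : eps * (C2 + C2) = eps * (2 * C2) by ring.
lra.
Qed.

(** With the outer pair fixed, [F] is maximal at [s = b] among [0 <= s <= b], so its derivative at
    [b] is nonnegative. That derivative is [E_f - w b]. *)
Lemma log_modulus x y : Om x -> Om y -> x != y ->
  w (rdist x y / 2) <= Eg (fun x => - ln (u x)) x y.
Proof.
move=> Ox Oy xy; have [Xi [dXi le0]] := four_point_log_le0.
have b0 : 0 < rdist x y / 2 by rewrite divr_gt0// rdist_gt0.
have : rdist x y / 2 <= D / 2 by rewrite ler_pM2r ?invr_gt0// diam.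
move: b0; set b := rdist x y / 2 => b0 bD.
have bn : b != 0 by rewrite gt_eqF.
pose z := inner 0 x y; pose e := (2 * b)^-1 *: (y - x).
have ee : dot e e = 1.
  rewrite /e dotZl dotZr -opprB dotNl dotNr opprK -enorm_sqr -/(rdist x y).
  have -> : rdist x y = 2 * b by rewrite /b; field.
  by field.
have lineE r : z + r *: e = inner (- (r / b)) x y.
  by apply/rowP => i; rewrite !mxE; field.
have lineN r : z + r *: (- e) = inner (r / b) x y.
  by rewrite scalerN -scaleNr lineE mulNr opprK.
have seg r : `|r| <= b -> Om (z + r *: e).
  move=> rb; rewrite lineE; apply: strictly_convex_inner => //.
  by rewrite normrN normrM normfV (gtr0_norm b0) ler_pdivrMr// mul1r.
have yE : y = z + b *: e.
  by rewrite lineE divff//; apply/rowP => i; rewrite !mxE; field.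
have xE : x = z + b *: (- e).
  by rewrite lineN divff//; apply/rowP => i; rewrite !mxE; field.
have [Mf [Jf cMf]] := jet2_on_neg_ln oO Cu up.
have EgE := Eg_symmetric oO Jf cMf ee b0 seg.
rewrite -scalerN -xE -yE in EgE; rewrite EgE.
pose F s : R := - ln (u (z + s *: e)) + - ln (u (z + s *: (- e))) - Xi s.
have Fmono s : 0 <= s <= b -> F s <= F b.
  move=> /andP[s0 sb]; have sb1 : `|s / b| <= 1.
    by rewrite normrM normfV (gtr0_norm b0) (ger0_norm s0) ler_pdivrMr// mul1r.
  have := le0 x y (s / b) Ox Oy sb1; rewrite /four_point -/b divfK// -lineE -lineN /F.
  by rewrite {1}xE {1}yE; lra.
have dF : is_derive b 1 F (dot ((- (u y)^-1) *: grad u y) e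
    + dot ((- (u x)^-1) *: grad u x) (- e) - w b).
  have dy := (is_derive_line (fun x => - ln (u x)) z e b
     (dot ((- (u y)^-1) *: grad u y) e)).1.
  have dx := (is_derive_line (fun x => - ln (u x)) z (- e) b
     (dot ((- (u x)^-1) *: grad u x) (- e))).1.
  rewrite -yE in dy; rewrite -xE in dx.
  have dX : is_derive b 1 Xi (w b).
    have := dXi b; rewrite gtr0_norm// /odd_ext gtr0_sg// mul1r gtr0_norm//.
    by apply; exact: le_lt_trans bD DL.
  exact: (is_deriveB (is_deriveD (dy (Jf y Oy e).1) (dx (Jf x Ox (- e)).1)) dX).
move: dF; rewrite dotNr; set d := _ - w b => dF.
suff d0 : 0 <= d by move: d0; rewrite /d; lra.
rewrite leNgt; apply/negP => dneg.
have nd : 0 < - d / 2 by lra.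
have [r r0 Hr] := is_derive_bound dF nd.
pose h := Num.min r b / 2.
have m0 : 0 < Num.min r b by rewrite lt_min r0.
have h0 : 0 < h by rewrite divr_gt0.
have hr : h < r.
  have : Num.min r b <= r by rewrite ge_min lexx.
  by rewrite /h; lra.
have hb : h < b.
  have : Num.min r b <= b by rewrite ge_min lexx orbT.
  by rewrite /h; lra.
have := Hr (- h); rewrite normrN gtr0_norm// => /(_ hr).
rewrite ler_norml => /andP[+ _].
have : F (b - h) <= F b by apply: Fmono; apply/andP; split; lra.
have : 0 < h * - d by rewrite mulr_gt0//; lra.
rewrite [- h * d]mulNr [- d / 2 * h](_ : _ = (h * - d) / 2); last by ring.
lra.
Qed.

End FourPointInequality.

(** * The choice of [w] and the passage to [m] *)

(* [m] is at most the larger root of [p p1 X^2 - a X - f]. *)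
Lemma quadratic_root_le (R : rcfType) (m a f p p1 : R) : 0 <= m -> 0 <= f -> 0 < p -> 0 < p1 ->
  m <= (a + Num.sqrt (a ^+ 2 + 4 * f * p * p1)) / (2 * p1 * p) ->
  m * (m * (p * p1) - a) <= f.
Proof.
move=> m0 f0 p0 p10.
have pp : 0 < p * p1 by rewrite mulr_gt0.
have E : 2 * p1 * p = 2 * (p * p1) by ring.
rewrite E ler_pdivlMr ?mulr_gt0// => H.
set s := Num.sqrt _ in H.
have D0 : 0 <= a ^+ 2 + 4 * f * p * p1.
  by rewrite addr_ge0 ?sqr_ge0// !mulr_ge0// ltW.
have s0 : 0 <= s by exact: sqrtr_ge0.
have ss : s ^+ 2 = a ^+ 2 + 4 * f * p * p1 by rewrite sqr_sqrtr.
(* Squaring needs a nonnegative left side. Otherwise [m p p1 - a <= - m p p1 <= 0], and the claim is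
   immediate. *)
have [X0|X0] := leP (2 * m * (p * p1) - a) 0.
  apply: le_trans f0; rewrite mulr_ge0_le0//.
  have := mulr_ge0 m0 (ltW pp); lra.
have X2 : (2 * m * (p * p1) - a) ^+ 2 <= s ^+ 2.
  by rewrite lerXn2r// ?nnegrE ?(ltW X0)//; lra.
rewrite -(ler_pM2r pp); rewrite ss in X2.
have E1 : (2 * m * (p * p1) - a) ^+ 2 - a ^+ 2
   = 4 * (m * (m * (p * p1) - a) * (p * p1)) by ring.
have E2 : 4 * f * p * p1 = 4 * (f * (p * p1)) by ring.
lra.
Qed.

Lemma root_ge0 (R : rcfType) (a f p p1 : R) : 0 <= f -> 0 < p -> 0 < p1 ->
  0 <= (a + Num.sqrt (a ^+ 2 + 4 * f * p * p1)) / (2 * p1 * p).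
Proof.
move=> f0 p0 p10; rewrite divr_ge0 ?mulr_ge0 ?(ltW p0) ?(ltW p10)//.
have : `|a| <= Num.sqrt (a ^+ 2 + 4 * f * p * p1).
  by rewrite -sqrtr_sqr ler_wsqrtr// lerDl !mulr_ge0// ltW.
have := ler_norm (- a); rewrite normrN; lra.
Qed.

(** Parallelogram law: [|x - y|^2 <= 2 |x|^2 + 2 |y|^2 <= 4 M^2]. *)
Lemma rdist_bounded (R : realType) (n : nat) (x y : 'rV[R]_n) (M : R) :
  enorm x <= M -> enorm y <= M -> rdist x y <= 2 * M.
Proof.
move=> xM yM; have M0 : 0 <= M := le_trans (enorm_ge0 x) xM.
have sq (v : 'rV[R]_n) : enorm v <= M -> dot v v <= M ^+ 2.
  by move=> vM; rewrite -enorm_sqr lerXn2r// nnegrE ?enorm_ge0.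
rewrite /rdist enormE -[leRHS]ger0_norm ?mulr_ge0// -sqrtr_sqr ler_wsqrtr//.
have := dotvv_ge0 (x + y); have := sq x xM; have := sq y yM.
rewrite !dotDl !dotDr !dotNl !dotNr opprK (dotC y x) exprMn; lra.
Qed.

Lemma rdist_le_diameter (R : realType) (n : nat) (Om : set 'rV[R]_n) :
  (exists M : R, forall x, Om x -> enorm x <= M) ->
  forall x y, Om x -> Om y -> rdist x y <= diameter Om.
Proof.
move=> [M HM] x y Ox Oy; apply: ub_le_sup; last by exists x, y.
exists (2 * M) => _ [x' [y' [Ox' [Oy' ->]]]].
by apply: rdist_bounded; exact: HM.
Qed.

Theorem theorem3p5 (R : realType) (n : nat) (Omega : set 'rV[R]_n)
  (q u : 'rV[R]_n -> R) (psi phi : R -> R) (D : R) :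
  bounded_domain Omega -> strictly_convex Omega -> smooth_boundary Omega ->
  D = diameter Omega ->
  smooth_closure Omega q ->
  first_eigenfunction Omega q u ->
  (forall x, Omega x -> 0 <= u x) ->
  smooth_interval 0 (D / 2) psi ->
  psi 0 = 0 -> derive1 (derive1 psi) 0 = 0 ->
  (forall s, 0 <= s <= D / 2 -> 0 < derive1 psi s) ->
  (forall s, 0 <= s <= D / 2 -> 0 <= phi s) ->
  (forall x y, Omega x -> Omega y -> Eg q x y >= phi (rdist x y / 2)) ->
  let m := inf [set (derive1 (derive1 psi) s
                     + Num.sqrt (derive1 (derive1 psi) s ^+ 2
                                 + 4 * phi s * psi s * derive1 psi s))
                    / (2 * derive1 psi s * psi s)
               | s in `]0, D / 2]] in
  let f := fun x => - ln (u x) in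
  forall x y, Omega x -> Omega y -> Eg f x y >= m * psi (rdist x y / 2).
Proof.
move=> [oO [conn [_ bdd]]] scO sbO DE [U [oU [clU Sq]]] [lam [eig _]] u_ge0.
move=> [e [e0 dpsi]] psi0 _ psi1 phi0 Eq.
set S := (X in inf X); move=> m f x y Ox Oy.
have [->|xy] := eqVneq x y.
  by rewrite /Eg eqxx /rdist subrr -[0 as X in enorm X](scale0r 0) enormZ normr0
    !mul0r psi0 mulr0.
have [Cu [cuO [ub [unz pde]]]] := eig.
have diam : forall a b, Omega a -> Omega b -> rdist a b <= D.
  by rewrite DE; exact: rdist_le_diameter.
have cO := compact_closure_bounded bdd.
have cq a : closure Omega a -> {for a, continuous q}.
  by move=> /clU Ua; exact: Ck_on_continuous (Sq 2) Ua.
have sub : Omega `<=` U by move=> a /subset_closure/clU.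
have Jq := jet2_on_sub sub (Ck_on_jet2 oU (Sq 2)).
have cMq a v : Omega a -> {for a, continuous (fun b => dot (v *m hessmx q b) v)}.
  by move=> /sub Ua; exact: Ck_on_continuous_qform (Sq 2) Ua.
have eqn a : Omega a -> \tr (hessmx u a) = (q a - lam) * u a.
  move=> /pde; rewrite laplacian_hessmx => H; lra.
(* The Laplacian of [u] is [(q - lam) u], at most a nonnegative constant times [u], so the strong
   maximum principle makes the logarithm meaningful. *)
have up a : Omega a -> 0 < u a.
  have [C HC] := compact_ub cO cq.
  have C0 : 0 <= Num.max (C - lam) 0 by rewrite le_max lexx orbT.
  apply: (strong_maximum oO conn (Ck_on_jet2 oO Cu) C0 _ u_ge0 _ unz) => b Ob.
    exact: Ck_on_continuous Cu Ob.
  rewrite eqn// ler_wpM2r ?u_ge0// le_max lerD2r HC//; exact: subset_closure.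
have b0 : 0 < rdist x y / 2 by rewrite divr_gt0// rdist_gt0.
have bD : rdist x y / 2 <= D / 2 by rewrite ler_pM2r ?invr_gt0// diam.
have D0 : 0 < D / 2 := lt_le_trans b0 bD.
(* Beyond [D / 2] but inside the interval of smoothness, so that derivatives are two-sided up to
   [D / 2]. *)
pose L := D / 2 + e / 2.
have L0 : 0 < L by rewrite /L; lra.
have DL : D / 2 < L by rewrite /L; lra.
have dk k (s : R) : 0 <= s <= L ->
    is_derive s 1 (derive1n k psi) (derive1n k.+1 psi s).
  move=> /andP[s0 sL]; split; last by rewrite -derive1E.
  by apply: dpsi; apply/andP; split; move: sL; rewrite /L; lra.
have psi_gt0 s : 0 < s <= D / 2 -> 0 < psi s.
  move=> /andP[s0 sD].
  have [||c] := @MVT R psi (derive1 psi) 0 s s0.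
  - move=> r; rewrite in_itv/= => /andP[r0 rs]; apply: (dk 0%N).
    by apply/andP; split; lra.
  - apply: derivable_within_continuous => r; rewrite in_itv/= => /andP[r0 rs].
    by apply: ex_derive; apply: (dk 0%N); apply/andP; split; lra.
  rewrite in_itv/= psi0 !subr0 => /andP[c0 cs] ->; rewrite mulr_gt0// psi1//.
  by apply/andP; split; lra.
have lbS : lbound S 0.
  move=> _ [s sD <-]; move: sD; rewrite /= in_itv/= => /[dup] sD /andP[s0 sD'].
  by apply: root_ge0; [apply: phi0|exact: psi_gt0|apply: psi1]; rewrite ltW.
have hasS : has_inf S.
  split; last by exists 0.
  by eexists; exists (D / 2) => //=; rewrite in_itv/= D0 lexx.
have m0 : 0 <= m by apply: lb_le_inf => //; case: hasS.
have mS s : 0 < s <= D / 2 ->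
    m * (m * (psi s * derive1 psi s) - derive1 (derive1 psi) s) <= phi s.
  move=> sD; have /andP[s0 sD'] := sD.
  have sD2 : 0 <= s <= D / 2 by rewrite ltW.
  apply: quadratic_root_le => //; [exact: phi0|exact: psi_gt0|exact: psi1|].
  apply: ge_inf; first by case: hasS.
  by exists s => //=; rewrite in_itv/= s0.
have modulus (w w1 w2 K k : R -> R) : w 0 = 0 ->
    (forall s : R, 0 <= s <= L ->
      [/\ is_derive s 1 w (w1 s), is_derive s 1 w1 (w2 s) & is_derive s 1 K (k s)]) ->
    (forall s, 0 < s <= D / 2 -> w s * w1 s - w2 s + k s <= phi s) ->
    (forall s, 0 < s <= D / 2 -> 0 < k s) -> w (rdist x y / 2) <= Eg f x y.
  move=> w0 dw ineq kpos.
  exact: (log_modulus oO cO scO sbO cq Jq cMq Cu cuO ub up eqn diam Eq L0 DL w0 dw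
    ineq kpos Ox Oy xy).
have [mE|mn] := eqVneq m 0.
  (* Any convex [w] with [w w' < w''] will do: take [w] a small multiple of [s^3]. *)
  pose c := (D / 2) ^- 4.
  have c0 : 0 < c by rewrite invr_gt0 exprn_gt0.
  have dX (s : R) k : is_derive s 1 (fun r : R => r ^+ k.+1) (k.+1%:R * s ^+ k).
    by split; [exact: exprn_derivable | rewrite exp_derive /GRing.scale/= mulr1].
  rewrite mE mul0r; apply: (@le_trans _ _ (c * (rdist x y / 2) ^+ 3)).
    by rewrite mulr_ge0 ?exprn_ge0 ?(ltW b0) ?(ltW c0).
  apply: (modulus (fun s => c * s ^+ 3) (fun s => 3 * c * s ^+ 2)
    (fun s => 6 * c * s) (fun s => 3 * c / 2 * s ^+ 2) (fun s => 3 * c * s)).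
  - by rewrite expr0n mulr0.
  - move=> s _; split.
    + by apply: is_derive_eq (is_deriveZ c (dX s 2%N)) _; rewrite /GRing.scale/=; ring.
    + by apply: is_derive_eq (is_deriveZ (3 * c) (dX s 1%N)) _; rewrite /GRing.scale/=; ring.
    + by apply: is_derive_eq (is_deriveZ (3 * c / 2) (dX s 1%N)) _;
        rewrite /GRing.scale/=; field.
  - move=> s /andP[s0 sD]; apply: (@le_trans _ _ 0); last by apply: phi0; rewrite ltW.
    (* The constant [c] is chosen for this bound: [w w' - w'' + k] equals [3 c s (c s^4 - 1)]. *)
    have cs : c * s ^+ 4 <= 1.
      rewrite /c mulrC ler_pdivrMr ?exprn_gt0// mul1r.
      by rewrite lerXn2r// nnegrE ltW.
    have -> : c * s ^+ 3 * (3 * c * s ^+ 2) - 6 * c * s + 3 * c * s =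
        3 * c * s * (c * s ^+ 4 - 1) by ring.
    by rewrite mulr_ge0_le0 ?subr_le0// !mulr_ge0// ltW.
  - by move=> s /andP[s0 _]; rewrite !mulr_gt0.
have {}m0 : 0 < m by rewrite lt_neqAle eq_sym mn.
(* For [w = m' psi] and [k = m' (m - m') psi psi'] the sum [w w' - w'' + k] is [m' / m] times
   [m (m psi psi' - psi'')], which is at most [phi] by the choice of [m]. *)
have key m' : 0 < m' < m -> m' * psi (rdist x y / 2) <= Eg f x y.
  move=> /andP[m'0 m'm].
  apply: (modulus (fun s => m' * psi s) (fun s => m' * derive1 psi s)
    (fun s => m' * derive1 (derive1 psi) s)
    (fun s => m' * (m - m') / 2 * (psi s * psi s))
    (fun s => m' * (m - m') * (psi s * derive1 psi s))).
  - by rewrite psi0 mulr0.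
  - move=> s sL; have d0 := dk 0%N s sL; have d1 := dk 1%N s sL.
    split; [exact: is_deriveZ d0|exact: is_deriveZ d1|].
    apply: is_derive_eq (is_deriveZ (m' * (m - m') / 2) (is_deriveM d0 d0)) _.
    by rewrite /GRing.scale/=; field.
  - move=> s sD; have := mS s sD; set P := psi s * _; set A := derive1 _ s => H.
    have f0 : 0 <= phi s by apply: phi0; case/andP: sD => /ltW -> ->.
    have -> : m' * psi s * (m' * derive1 psi s) - m' * A + m' * (m - m') * P =
      (m' / m) * (m * (m * P - A)) by rewrite /P; field; rewrite gt_eqF.
    have mm : 0 <= m' / m by rewrite divr_ge0// ltW.
    apply: le_trans (ler_wpM2l mm H) _; rewrite ler_piMl//.
    by rewrite ler_pdivrMr// mul1r ltW.
  - move=> s sD; rewrite !mulr_gt0 ?subr_gt0//; first exact: psi_gt0.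
    by apply: psi1; case/andP: sD => /ltW -> ->.
have pb := psi_gt0 (rdist x y / 2); rewrite b0 bD in pb; have {}pb := pb isT.
rewrite leNgt; apply/negP => H.
(* The midpoint between [m] and the ratio that is assumed to be smaller than [m]; this ratio is
   positive by the case [m / 2]. *)
pose m' := (Eg f x y / psi (rdist x y / 2) + m) / 2.
have E0 : 0 < Eg f x y.
  apply: lt_le_trans (key (m / 2) _); first by rewrite mulr_gt0// divr_gt0.
  by apply/andP; split; lra.
have Em : Eg f x y / psi (rdist x y / 2) < m by rewrite ltr_pdivrMr.
have Em0 : 0 < Eg f x y / psi (rdist x y / 2) by rewrite divr_gt0.
have m'm : 0 < m' < m by rewrite /m'; apply/andP; split; lra.
have := key m' m'm; rewrite /m' mulrAC mulrDl divfK ?gt_eqF//; lra.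
Qed.
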